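(* The optimal boundary $t\mapsto b(t)$ is non-increasing on $[0,1]$.
   Context: Let $(\Omega,\mathcal{F},(\mathcal{F}_t)_{t\ge 0},\mathsf{P})$ be a complete filtered probability space carrying a standard one-dimensional Brownian motion $W=(W_t)_{t\ge0}$, where $(\mathcal{F}_t)$ is the filtration generated by $W$ augmented with $\mathsf{P}$-null sets. For $t\in[0,1)$ and $x\in\mathbb{R}$, let $X^{t,x}=(X^{t,x}_s)_{s\in[t,1]}$ be the Brownian bridge started at $x$ at time $t$ and pinned at $0$ at time $1$: $$X^{t,x}_s=(1-s)\Big(\frac{x}{1-t}+\int_t^s\frac{\mathrm{d}W_u}{1-u}\Big),\quad s\in[t,1),\qquad X^{t,x}_1=0,$$ i.e. the strong solution of $\mathrm{d}X_s=-\frac{X_s}{1-s}\,\mathrm{d}s+\mathrm{d}W_s$, $s\in[t,1)$, $X_t=x$. Write $\mathsf{E}_{t,x}[\,\cdot\,]=\mathsf{E}[\,\cdot\,|X_t=x]$. The value function is $$v(t,x)=\sup_{0\le\tau\le1-t}\mathsf{E}_{t,x}\big[e^{X_{t+\tau}}\big],\qquad (t,x)\in[0,1]\times\mathbb{R},$$ where the supremum is over random times $\tau\in[0,1-t]$ such that $t+\tau$ is an $(\mathcal{F}_s)_{s\ge t}$-stopping time; in particular $v(1,x)=e^x$. The optimal boundary is the function $b$ on $[0,1]$ (with values a priori in $[0,+\infty]$) defined by $b(t):=\sup\{x\in\mathbb{R}:v(t,x)>e^x\}$ for $t\in[0,1)$ and $b(1):=0$. *)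

(* Defs.v *)
From HB Require Import structures.
From mathcomp Require Import all_boot all_order all_algebra.
From mathcomp Require Import all_classical all_reals all_analysis.

Set Implicit Arguments.
Unset Strict Implicit.
Unset Printing Implicit Defensive.

Import Order.TTheory GRing.Theory Num.Theory.
Import numFieldNormedType.Exports.

Local Open Scope classical_set_scope.
Local Open Scope ring_scope.

(* Processes are indexed by R; only the times lying in [0, +oo[ (for the
   Brownian motion) or in [t, 1] (for the bridge started at time t) matter. *)

Definition natural_filtration (R : realType) (d : measure_display)
    (Omega : measurableType d) (W : R -> Omega -> R) (t : R) :
    set (set Omega) :=
  <<s \bigcup_(u in `[0, t]) preimage_set_system setT (W u) measurable >>.

Definition augmented_filtration (R : realType) (d : measure_display)
    (Omega : measurableType d) (P : probability Omega R)
    (W : R -> Omega -> R) (t : R) : set (set Omega) :=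
  <<s natural_filtration W t `|` [set N | P.-negligible N] >>.

(* The second argument of [normal_prob] is the standard deviation. *)
Definition standard_brownian_motion (R : realType) (d : measure_display)
    (Omega : measurableType d) (P : probability Omega R)
    (W : R -> Omega -> R) : Prop :=
  [/\ forall t : R, 0 <= t -> measurable_fun setT (W t),
      {ae P, forall w, W 0 w = 0},
      {ae P, forall w, {within `[0, +oo[, continuous (fun t => W t w)}},
      forall s t : R, 0 <= s -> s < t -> forall B : set R, measurable B ->
        P ((fun w => W t w - W s w)%R @^-1` B) = normal_prob 0 (Num.sqrt (t - s)) B
    & forall s t : R, 0 <= s -> s < t ->
        forall A, natural_filtration W s A ->
        forall B : set R, measurable B ->
        P (A `&` (fun w => W t w - W s w)%R @^-1` B) = (P A * P ((fun w => W t w - W s w)%R @^-1` B))%E].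

(* [X] is the strong solution of dX_s = - X_s / (1 - s) ds + dW_s on [t, 1[
   with X_t = x, pinned at X_1 = 0.  The noise being additive, the equation in
   integral form only involves a pathwise integral in time, and
   \int_t^s dW_u = W_s - W_t; the initial condition is the case s = t. *)
Definition brownian_bridge (R : realType) (d : measure_display)
    (Omega : measurableType d) (P : probability Omega R)
    (W : R -> Omega -> R) (t x : R) (X : R -> Omega -> R) : Prop :=
  [/\ forall s, t <= s < 1 -> forall B : set R, measurable B ->
        augmented_filtration P W s (X s @^-1` B),
      {ae P, forall w, {within `[t, 1[, continuous (fun s => X s w)}},
      {ae P, forall w, forall s, t <= s < 1 ->
        X s w = x - \int[lebesgue_measure]_(u in `[t, s]) (X u w / (1 - u))
                + (W s w - W t w)}
    & {ae P, forall w, X 1 w = 0}].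

(* Random times tau with values in [0, 1 - t] such that t + tau is a stopping
   time of (F_s)_{s >= t}. *)
Definition admissible (R : realType) (d : measure_display)
    (Omega : measurableType d) (P : probability Omega R)
    (W : R -> Omega -> R) (t : R) : set (Omega -> R) :=
  [set tau | (forall w, 0 <= tau w <= 1 - t) /\
             forall s, t <= s ->
               augmented_filtration P W s [set w | t + tau w <= s]].

(* [X t x] is the bridge started at x at time t; it only exists for t < 1. *)
Definition value (R : realType) (d : measure_display)
    (Omega : measurableType d) (P : probability Omega R)
    (W : R -> Omega -> R) (X : R -> R -> R -> Omega -> R) (t x : R) : \bar R :=
  if t < 1 then
    ereal_sup [set ('E_P[fun w => expR (X t x (t + tau w)%R w)])%E |
               tau in admissible P W t]
  else (expR x)%:E.

Definition optimal_boundary (R : realType) (d : measure_display)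
    (Omega : measurableType d) (P : probability Omega R)
    (W : R -> Omega -> R) (X : R -> R -> R -> Omega -> R) (t : R) : \bar R :=
  if t < 1 then
    ereal_sup [set x%:E | x in [set x : R | ((expR x)%:E < value P W X t x)%E]]
  else 0%E.

(* Main.v *)
Require Import Defs.
From HB Require Import structures.
From mathcomp Require Import all_boot all_order all_algebra.
From mathcomp Require Import all_classical all_reals all_analysis.
From mathcomp Require Import measurable_realfun.
From mathcomp Require Import ring lra.

Set Implicit Arguments.
Unset Strict Implicit.
Unset Printing Implicit Defensive.

Import Order.TTheory GRing.Theory Num.Theory.
Import numFieldNormedType.Exports.

Local Open Scope classical_set_scope.
Local Open Scope ring_scope.

(** Write c = sqrt (1 - t).  Brownian scaling turns the bridge started at x at
    time t into X_(t + (1 - t) u) = (1 - u) (x + c Z_u), where the process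
    Z_u = \int_0^u dB_r / (1 - r), with B a Brownian motion, has a law that does
    not depend on (t, x).  Stopping at u therefore pays
    exp ((1 - u) (x + c Z_u)), which is convex in c, and a supremum of
    expectations of such payoffs is still convex in c.  For x >= 0 its value at
    c = 0 is exp x, the payoff of stopping at once, and it is never below exp x.
    So once it exceeds exp x at some c, it does so at every larger c, that is, at
    every earlier t: v(t, x) > exp x and s <= t imply v(s, x) > exp x.  Together
    with b >= 0, which holds because running until time 1 pays exactly 1, this
    is the monotonicity of b.

    The difficulty is that stopping times for different t live on the same
    probability space but for different filtrations, so they cannot be
    transported by scaling.  The comparison is made instead on a quantity that
    only involves laws.  The interval [t, 1] is cut by the rescaled mesh
    t + (1 - t) k / (n + 1); along it the bridge is an affine function of a
    random walk whose increments are independent of the past and have a law that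
    does not depend on (t, x) ([bridge_walk_increment_law]).  Hence the optimal
    value of stopping on the mesh is given by backward induction ([snell]), with
    c as a mere parameter ([stopped_bridge_le], [mesh_value_attained]), and
    convexity in c goes through the induction ([snell_volatility_convex]).
    Rounding stopping times up to the mesh and applying Fatou's lemma shows that
    v(t, x) > exp x exactly when this holds on some mesh ([value_gtP]).

    The increments of the walk are the integrals of 1 / (1 - r) against W.  No
    stochastic integral is needed: by the equation that X satisfies they are
    pathwise limits of Riemann sums ([riemann_noise_cvg]), the laws of these sums
    scale because Gaussian laws do ([rescaled_noise_law]), and equality in law
    passes to almost sure limits ([law_limit]). *)

(** * Equality in law *)

Lemma image_law_unique (R : realType) (d1 d2 d3 : measure_display)
    (T1 : measurableType d1) (T2 : measurableType d2) (T3 : measurableType d3)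
    (m1 : {finite_measure set T1 -> \bar R})
    (m2 : {finite_measure set T2 -> \bar R})
    (f1 : T1 -> T3) (f2 : T2 -> T3) (G : set (set T3)) :
  measurable_fun setT f1 -> measurable_fun setT f2 ->
  measurable = <<s G >> -> setI_closed G -> G setT ->
  (forall B, G B -> m1 (f1 @^-1` B) = m2 (f2 @^-1` B)) ->
  forall B, measurable B -> m1 (f1 @^-1` B) = m2 (f2 @^-1` B).
Proof.
move=> mf1 mf2 mG GI GT m12 B mB.
pose f1' : {mfun T1 >-> T3} := HB.pack f1 (isMeasurableFun.Build _ _ _ _ _ mf1).
pose f2' : {mfun T2 >-> T3} := HB.pack f2 (isMeasurableFun.Build _ _ _ _ _ mf2).
have := @measure_unique _ R T3 G (fun=> setT) mG GI (fun=> GT) _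
  (pushforward m1 f1') (pushforward m2 f2').
apply => //.
- by rewrite bigcup_const.
- by move=> _; rewrite /= /pushforward preimage_setT; exact: fin_num_fun_lty.
Qed.

Section equality_in_law.
Context (R : realType) (d1 d2 : measure_display).
Context (T1 : measurableType d1) (T2 : measurableType d2).
Variables (m1 : {finite_measure set T1 -> \bar R}).
Variables (m2 : {finite_measure set T2 -> \bar R}).

Lemma integral_equal_laws (d3 : measure_display) (T3 : measurableType d3)
    (f1 : T1 -> T3) (f2 : T2 -> T3) (phi : T3 -> \bar R) :
  measurable_fun setT f1 -> measurable_fun setT f2 ->
  (forall B, measurable B -> m1 (f1 @^-1` B) = m2 (f2 @^-1` B)) ->
  measurable_fun setT phi -> (forall y, 0 <= phi y)%E ->
  (\int[m1]_x phi (f1 x) = \int[m2]_x phi (f2 x))%E.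
Proof.
move=> mf1 mf2 f12 mphi phi0.
pose f1' : {mfun T1 >-> T3} := HB.pack f1 (isMeasurableFun.Build _ _ _ _ _ mf1).
pose f2' : {mfun T2 >-> T3} := HB.pack f2 (isMeasurableFun.Build _ _ _ _ _ mf2).
have -> : (\int[m1]_x phi (f1 x) = \int[pushforward m1 f1']_y phi y)%E.
  by rewrite ge0_integral_pushforward// preimage_setT.
have -> : (\int[m2]_x phi (f2 x) = \int[pushforward m2 f2']_y phi y)%E.
  by rewrite ge0_integral_pushforward// preimage_setT.
by apply: eq_measure_integral => A mA _; exact: f12.
Qed.

(** Agreement on rectangles determines the joint law, hence the law of the sum. *)
Lemma law_add_unique (Y1 Z1 : T1 -> R) (Y2 Z2 : T2 -> R) :
  measurable_fun setT Y1 -> measurable_fun setT Z1 ->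
  measurable_fun setT Y2 -> measurable_fun setT Z2 ->
  (forall B C, measurable B -> measurable C ->
    m1 (Y1 @^-1` B `&` Z1 @^-1` C) = m2 (Y2 @^-1` B `&` Z2 @^-1` C)) ->
  forall B, measurable B ->
    m1 ((Y1 \+ Z1) @^-1` B) = m2 ((Y2 \+ Z2) @^-1` B).
Proof.
move=> mY1 mZ1 mY2 mZ2 YZ B mB.
pose f1 x := (Y1 x, Z1 x); pose f2 x := (Y2 x, Z2 x).
have mf1 : measurable_fun setT f1 by exact: measurable_fun_pair.
have mf2 : measurable_fun setT f2 by exact: measurable_fun_pair.
pose D := (fun p : R * R => p.1 + p.2) @^-1` B.
have mD : measurable D.
  rewrite -[D]setTI; apply: (measurable_funD measurable_fst measurable_snd) => //.
pose G : set (set (R * R)) :=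
  [set C | exists A, measurable A /\ exists B, measurable B /\ C = A `*` B].
apply: (@image_law_unique R _ _ _ T1 T2 _ m1 m2 f1 f2 G mf1 mf2 _ _ _ _ D mD).
- rewrite measurable_prod_measurableType //; congr (<<s _ >>).
  rewrite predeqE; split => [[A mA [C mC <-]]|[A [mA [C [mC ->]]]]].
    by exists A; split => //; exists C.
  by exists A => //; exists C.
- move=> /= _ _ [X1 [mX1 [X2 [mX2 ->]]]] [Z3 [mZ3 [Z4 [mZ4 ->]]]].
  rewrite -setXI; exists (X1 `&` Z3); split; first exact: measurableI.
  by exists (X2 `&` Z4); split => //; exact: measurableI.
- by exists setT; split => //; exists setT; split => //; rewrite setXTT.
- by move=> _ [A [mA [C [mC ->]]]]; exact: YZ.
Qed.

End equality_in_law.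

Lemma integral_probability_cst (R : realType) (d : measure_display)
    (T : measurableType d) (m : probability T R) (c : \bar R) :
  (\int[m]_x c = c)%E.
Proof.
rewrite integral_cst// [X in (_ * X)%E](_ : _ = 1%E) ?mule1//.
exact: probability_setT.
Qed.

Lemma bounded_cvg_integral (R : realType) (d : measure_display)
    (T : measurableType d) (m : {finite_measure set T -> \bar R})
    (f : (T -> R)^nat) (g : T -> R) :
  (forall n, measurable_fun setT (f n)) -> measurable_fun setT g ->
  (forall n x, `|f n x| <= 1) -> {ae m, forall x, f ^~ x @ \oo --> g x} ->
  (\int[m]_x (f n x)%:E @[n --> \oo] --> \int[m]_x (g x)%:E)%E.
Proof.
move=> mf mg f1 fg.
have [] // := @dominated_convergence _ T R m setT measurableT
   (fun n x => (f n x)%:E) (fun x => (g x)%:E) (cst 1%:E).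
- by move=> n; exact/measurable_EFinP.
- exact/measurable_EFinP.
- apply: filterS fg => x fx _.
  exact: cvg_EFin (nearW _ _) fx.
- exact: finite_measure_integrable_cst.
- by apply: aeW => x n _; rewrite lee_fin.
Qed.

(** Continuous functions increasing with n to the indicator of `]-oo, a[: they
    are the test functions that separate laws on the line. *)
Definition ramp (R : realType) (a : R) (n : nat) (y : R) : R :=
  Num.min 1 (Num.max 0 (n%:R * (a - y))).

Section ramp.
Context (R : realType) (a : R).

Lemma ramp_ge0 n y : 0 <= ramp a n y.
Proof. by rewrite /ramp le_min ler01 le_max lexx. Qed.

Lemma ramp_le1 n y : ramp a n y <= 1.
Proof. by rewrite /ramp ge_min lexx. Qed.

Lemma norm_ramp_le1 n y : `|ramp a n y| <= 1.
Proof. by rewrite ger0_norm ?ramp_ge0// ramp_le1. Qed.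

Lemma continuous_ramp n : continuous (ramp a n).
Proof.
move=> y.
apply: (@continuous_min R R (cst 1) (fun y => Num.max 0 (n%:R * (a - y)))).
  exact: cvg_cst.
apply: (@continuous_max R R (cst 0) (fun y => n%:R * (a - y))).
  exact: cvg_cst.
apply: (@continuousM R R (cst n%:R) (fun y => a - y)); first exact: cvg_cst.
by apply: (@continuousB R R R (cst a) id); [exact: cvg_cst|exact: cvg_id].
Qed.

Lemma measurable_ramp n : measurable_fun setT (ramp a n).
Proof. by apply: continuous_measurable_fun; exact: continuous_ramp. Qed.

Lemma ramp_cvg y : ramp a n y @[n --> \oo] --> (\1_`]-oo, a[ y : R).
Proof.
have [ya|ay] := ltP y a.
  rewrite indicE mem_set ?in_itv//=.
  apply: cvg_near_cst.
  have ay0 : 0 < a - y by rewrite subr_gt0.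
  near=> n; apply/min_idPl; rewrite le_max; apply/orP; right.
  rewrite -ler_pdivrMr// mul1r.
  by near: n; exact: nbhs_infty_ger.
rewrite indicE memNset; last by rewrite /= in_itv/= ltNge ay.
apply: cvg_near_cst; apply: nearW => n.
rewrite /ramp [Num.max _ _](_ : _ = 0) ?min_r ?ler01//.
by apply/max_idPl; rewrite mulr_ge0_le0// subr_le0.
Unshelve. all: by end_near. Qed.

End ramp.

(** Bounded continuous functions see almost sure limits, by dominated
    convergence, and ramps among them recover the measure of every open ray. *)
Lemma law_limit (R : realType) (d1 d2 : measure_display)
    (T1 : measurableType d1) (T2 : measurableType d2)
    (m1 : {finite_measure set T1 -> \bar R})
    (m2 : {finite_measure set T2 -> \bar R})
    (f1 : (T1 -> R)^nat) (f2 : (T2 -> R)^nat) (g1 : T1 -> R) (g2 : T2 -> R) :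
  (forall n, measurable_fun setT (f1 n)) ->
  (forall n, measurable_fun setT (f2 n)) ->
  measurable_fun setT g1 -> measurable_fun setT g2 ->
  {ae m1, forall x, f1 ^~ x @ \oo --> g1 x} ->
  {ae m2, forall x, f2 ^~ x @ \oo --> g2 x} ->
  (forall n B, measurable B -> m1 (f1 n @^-1` B) = m2 (f2 n @^-1` B)) ->
  forall B, measurable B -> m1 (g1 @^-1` B) = m2 (g2 @^-1` B).
Proof.
move=> mf1 mf2 mg1 mg2 fg1 fg2 f12.
have ramp_eq a k : (\int[m1]_x (ramp a k (g1 x))%:E =
                    \int[m2]_x (ramp a k (g2 x))%:E)%E.
  have ramplim d (T : measurableType d) (m : {finite_measure set T -> \bar R})
      (f : (T -> R)^nat) (g : T -> R) : (forall n, measurable_fun setT (f n)) ->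
      measurable_fun setT g -> {ae m, forall x, f ^~ x @ \oo --> g x} ->
      (\int[m]_x (ramp a k (f n x))%:E @[n --> \oo] -->
       \int[m]_x (ramp a k (g x))%:E)%E.
    move=> mf mg fg; apply: bounded_cvg_integral.
    - by move=> n; apply: measurableT_comp => //; exact: measurable_ramp.
    - by apply: measurableT_comp => //; exact: measurable_ramp.
    - by move=> n x; exact: norm_ramp_le1.
    - apply: filterS fg => x fx.
      by apply: continuous_cvg fx; exact: continuous_ramp.
  apply: (cvg_unique _ (ramplim _ _ m1 f1 g1 mf1 mg1 fg1)) => //.
  rewrite (_ : (fun n => _) = (fun n => \int[m2]_x (ramp a k (f2 n x))%:E)%E).
    exact: ramplim.
  apply/funext => n.
  apply: (integral_equal_laws (phi := fun y => (ramp a k y)%:E)) => //.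
  - exact: f12.
  - by apply/measurable_EFinP; exact: measurable_ramp.
  - by move=> y; rewrite lee_fin ramp_ge0.
have indlim d (T : measurableType d) (m : {finite_measure set T -> \bar R})
    (g : T -> R) a : measurable_fun setT g ->
    (\int[m]_x (ramp a n (g x))%:E @[n --> \oo] --> m (g @^-1` `]-oo, a[))%E.
  move=> mg.
  have mga : measurable (g @^-1` `]-oo, a[).
    by rewrite -[X in measurable X]setTI; exact: mg.
  rewrite -[X in m X]setIT -(integral_indic m measurableT mga).
  apply: (@bounded_cvg_integral R d T m (fun n x => ramp a n (g x))).
  - by move=> n; apply: measurableT_comp => //; exact: measurable_ramp.
  - exact: measurable_indic.
  - by move=> n x; exact: norm_ramp_le1.
  - by apply: aeW => x; exact: ramp_cvg.
have rays a : m1 (g1 @^-1` `]-oo, a[) = m2 (g2 @^-1` `]-oo, a[).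
  apply: (cvg_unique _ (indlim _ _ m1 g1 a mg1)) => //.
  rewrite (_ : (fun n => _) = (fun n => \int[m2]_x (ramp a n (g2 x))%:E)%E).
    exact: indlim.
  by apply/funext => n; exact: ramp_eq.
(* the whole line is added because it is not a ray and both measures must give
   it the same mass *)
pose G : set (set R) := [set A | A = setT \/ RGenInftyO.G A].
apply: (@image_law_unique R _ _ _ T1 T2 _ m1 m2 g1 g2 G mg1 mg2).
- rewrite [LHS]RGenInftyO.measurableE; apply/seteqP; split.
    by apply: sub_sigma_algebra2 => A ?; right.
  apply: smallest_sub; first exact: smallest_sigma_algebra.
  move=> A [->|GA]; last exact: sub_sigma_algebra.
  exact: (@measurableT _ (g_sigma_algebraType _)).
- move=> A B [->|GA] [->|GB]; rewrite ?setTI ?setIT; [by left|by right|by right|].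
  right; move: GA GB => [x ->] [y ->]; exists (Num.min x y).
  by apply/seteqP; split=> z /=; rewrite !in_itv/= lt_min => /andP.
- by left.
- move=> _ [->|[x ->]]; last exact: rays.
  have cover d (T : measurableType d) (m : {finite_measure set T -> \bar R})
    (g : T -> R) : measurable_fun setT g ->
     m (g @^-1` `]-oo, n%:R[) @[n --> \oo] --> m (g @^-1` setT).
    move=> mg; rewrite [X in g @^-1` X](_ : _ = \bigcup_n `]-oo, n%:R[%classic).
      rewrite preimage_bigcup; apply: nondecreasing_cvg_mu.
      - by move=> n; rewrite -[X in measurable X]setTI; exact: mg.
      - apply: bigcup_measurable => n _.
        by rewrite -[X in measurable X]setTI; exact: mg.
      - move=> n m' nm; apply/subsetPset => x /=; rewrite !in_itv/=.
        by move=> /lt_le_trans; apply; rewrite ler_nat.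
    apply/seteqP; split => // x _; exists (Num.bound `|x|) => //=.
    by rewrite in_itv/= (le_lt_trans (ler_norm _))// archi_boundP.
  apply: (cvg_unique _ (cover _ _ m1 g1 mg1)) => //.
  rewrite (_ : (fun n => _) = (fun n => m2 (g2 @^-1` `]-oo, n%:R[))).
    exact: cover.
  by apply/funext => n; exact: rays.
Qed.

(** * Integrating out an independent variable *)

(** Independence says that the image of P under w |-> (w, xi w), the first
    coordinate carrying the sub-sigma-algebra <<s G >>, is a product measure;
    the formula is then Tonelli's theorem. *)
Lemma freezing (R : realType) (d : measure_display) (Omega : measurableType d)
    (P : probability Omega R) (G : set (set Omega)) (xi : Omega -> R)
    (nu : probability R R)
    (f : g_sigma_algebraType G * R -> \bar R) :
  <<s G >> `<=` measurable -> measurable_fun setT xi ->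
  (forall A, <<s G >> A -> forall B, measurable B ->
    P (A `&` xi @^-1` B) = (P A * nu B)%E) ->
  measurable_fun setT f -> (forall z, 0 <= f z)%E ->
  (\int[P]_w f (w, xi w) = \int[P]_w \int[nu]_y f (w, y))%E.
Proof.
move=> sG mxi indep mf f0.
have mid : measurable_fun [set: Omega] (fun w => w : g_sigma_algebraType G).
  by move=> _ A mA; rewrite setTI; exact: sG.
pose idG : {mfun Omega >-> g_sigma_algebraType G} :=
  HB.pack (fun w : Omega => w : g_sigma_algebraType G)
    (isMeasurableFun.Build _ _ _ _ _ mid).
pose Z w : g_sigma_algebraType G * R := (w : g_sigma_algebraType G, xi w).
have mZ : measurable_fun [set: Omega] Z by exact: measurable_fun_pair.
pose Z' : {mfun Omega >-> (g_sigma_algebraType G * R)%type} :=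
  HB.pack Z (isMeasurableFun.Build _ _ _ _ _ mZ).
have prodE A : measurable A -> (distribution P idG \x nu)%E A = distribution P Z' A.
  move: A; apply: (product_measure_unique (m1 := distribution P idG) (m2 := nu)
    (m' := distribution P Z')) => B C mB mC.
  exact: indep.
transitivity (\int[distribution P Z']_z f z)%E.
  by rewrite ge0_integral_pushforward// preimage_setT.
transitivity (\int[(distribution P idG \x nu)%E]_z f z)%E.
  by apply: eq_measure_integral => A mA _; exact/esym/prodE.
rewrite fubini_tonelli1// ge0_integral_pushforward ?preimage_setT//.
  exact: measurable_fun_fubini_tonelli_F.
by move=> w _; exact: integral_ge0.
Qed.

(** * Augmentation by null sets *)

Section augmentation.
Context (R : realType) (d : measure_display) (Omega : measurableType d).
Variable P : probability Omega R.

Lemma measure_eq_mod_null (A B : set Omega) :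
  measurable A -> measurable B ->
  P.-negligible (A `\` B) -> P.-negligible (B `\` A) -> P A = P B.
Proof.
move=> mA mB AB BA; rewrite (measureDI P mA mB) (measureDI P mB mA).
rewrite (measure_negligible _ AB) ?(measure_negligible _ BA) 1?setIC//;
  exact: measurableD.
Qed.

(** The sets that differ from a member of G by a null set form a sigma-algebra,
    which contains the generators of the augmentation. *)
Lemma augmentation_mod_null (G : set (set Omega)) (A : set Omega) :
  sigma_algebra setT G -> <<s G `|` [set N | P.-negligible N] >> A ->
  exists2 A', G A' & P.-negligible (A `\` A') /\ P.-negligible (A' `\` A).
Proof.
move=> [G0 GC GU].
apply: (@smallest_sub _ (sigma_algebra setT) _
  [set A | exists2 A', G A' & P.-negligible (A `\` A') /\ P.-negligible (A' `\` A)]);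
  last first.
  move=> B [GB|nB] /=.
    by exists B => //; rewrite setDv; split; exact: negligible_set0.
  by exists set0 => //; rewrite setD0 set0D; split => //; exact: negligible_set0.
split => /=.
- by exists set0 => //; rewrite setDv; split; exact: negligible_set0.
- move=> B [B' GB' [BB' B'B]]; exists (setT `\` B'); first exact: GC.
  rewrite !setTD; split.
  + by apply: negligibleS B'B => w [/= nBw nnB']; split => //; exact: contrapT.
  + by apply: negligibleS BB' => w [/= nBw nnB']; split => //; exact: contrapT.
- move=> F FG.
  have /boolp.choice[F' FF'] n : exists A', G A' /\
      (P.-negligible (F n `\` A') /\ P.-negligible (A' `\` F n)).
    by have [A' ? ?] := FG n; exists A'.
  have GF' n : G (F' n) by have [] := FF' n.
  exists (\bigcup_n F' n); first exact: GU.
  split.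
  + apply: (negligibleS (A := \bigcup_n (F n `\` F' n))).
      by move=> w [[n _ Fn] nF']; exists n => //; split => // F'n; apply: nF'; exists n.
    by apply: negligible_bigcup => n; have [_ []] := FF' n.
  + apply: (negligibleS (A := \bigcup_n (F' n `\` F n))).
      by move=> w [[n _ Fn] nF']; exists n => //; split => // F'n; apply: nF'; exists n.
    by apply: negligible_bigcup => n; have [_ []] := FF' n.
Qed.

Lemma augmentation_measurable (G : set (set Omega)) :
  measure_is_complete P -> G `<=` measurable ->
  <<s G `|` [set N | P.-negligible N] >> `<=` measurable.
Proof.
move=> cP Gm; apply: smallest_sub; first exact: sigma_algebra_measurable.
by move=> A [/Gm//|nA]; exact: cP.
Qed.

Lemma augmentation_indep (G : set (set Omega)) (E : set Omega) :
  measure_is_complete P -> sigma_algebra setT G -> G `<=` measurable ->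
  measurable E ->
  (forall A, G A -> P (A `&` E) = (P A * P E)%E) ->
  forall A, <<s G `|` [set N | P.-negligible N] >> A ->
    P (A `&` E) = (P A * P E)%E.
Proof.
move=> cP sG Gm mE indep A GA.
have mA : measurable A by exact: augmentation_measurable cP Gm _ GA.
have [A' GA' [AA' A'A]] := augmentation_mod_null sG GA.
have mA' := Gm _ GA'.
rewrite (measure_eq_mod_null mA mA')// -indep//.
apply: measure_eq_mod_null; [exact: measurableI|exact: measurableI| | ].
- by apply: negligibleS AA' => w [[? ?] nA']; split => // ?; exact: nA'.
- by apply: negligibleS A'A => w [[? ?] nA']; split => // ?; exact: nA'.
Qed.

End augmentation.

(** * Scaling of Gaussian laws *)

Lemma lebesgue_measure_scale (R : realType) (a : R) (A : set (measurableTypeR R)) :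
  0 < a -> measurable A ->
  lebesgue_measure A = (a%:E * lebesgue_measure ((fun y => (a * y)%R) @^-1` A))%E.
Proof.
move=> a0 mA.
have ma : measurable_fun [set: measurableTypeR R]
    (fun y : measurableTypeR R => (a * y)%R : measurableTypeR R).
  exact: measurable_funM.
pose f : {mfun measurableTypeR R >-> measurableTypeR R} :=
  HB.pack (fun y : measurableTypeR R => (a * y)%R : measurableTypeR R)
  (isMeasurableFun.Build _ _ _ _ _ ma).
pose k : {nonneg R} := NngNum (ltW a0).
apply: (@lebesgue_measure_unique R (mscale k (pushforward lebesgue_measure f))) => //.
move=> _ [[x y]] _ <-; rewrite /= /mscale /pushforward /=.
rewrite [X in _ = (_ * lebesgue_measure X)%E](_ : _ = `]x / a, y / a]%classic).
  rewrite !lebesgue_measure_itv/= !lte_fin ltr_pM2r ?invr_gt0//.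
  case: ifPn => _; last by rewrite mule0.
  by rewrite -!EFinD -EFinM; congr (_%:E); field; rewrite gt_eqF.
apply/seteqP; split => z /=;
  by rewrite !in_itv/= ltr_pdivrMr// ler_pdivlMr// !(mulrC z a).
Qed.

Lemma normal_pdf_scale (R : realType) (a s y : R) : 0 < a -> 0 < s ->
  normal_pdf 0 s y = a * normal_pdf 0 (a * s) (a * y).
Proof.
move=> a0 s0; rewrite !normal_pdfE ?mulf_neq0 ?gt_eqF//.
rewrite /normal_fun/normal_peak.
rewrite !subr0 mulrA; congr (_ * expR _); last first.
  by field; rewrite !gt_eqF.
have -> : ((a * s) ^+ 2 * pi *+ 2 = a ^+ 2 * (s ^+ 2 * pi *+ 2))%R by ring.
rewrite sqrtrM ?sqr_ge0// sqrtr_sqr gtr0_norm// invfM mulrA divff ?mul1r//.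
by rewrite gt_eqF.
Qed.

Lemma normal_prob_scale (R : realType) (a s : R) (B : set R) :
  0 < a -> 0 < s -> measurable B ->
  normal_prob 0 s ((fun y => a * y) @^-1` B) = normal_prob 0 (a * s) B.
Proof.
move=> a0 s0 mB; rewrite /normal_prob.
have ma : measurable_fun [set: measurableTypeR R]
    (fun y : measurableTypeR R => (a * y)%R : measurableTypeR R).
  exact: measurable_funM.
pose f : {mfun measurableTypeR R >-> measurableTypeR R} :=
  HB.pack (fun y : measurableTypeR R => (a * y)%R : measurableTypeR R)
  (isMeasurableFun.Build _ _ _ _ _ ma).
pose k : {nonneg R} := NngNum (ltW a0).
pose m : {measure set (measurableTypeR R) -> \bar R} :=
  pushforward lebesgue_measure f.
transitivity (\int[mscale k (m ma)]_(x in B) (normal_pdf 0 (a * s) x)%:E)%E; last first.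
  apply: eq_measure_integral => A mA _; apply/esym.
  exact: lebesgue_measure_scale.
have mpdf : measurable_fun setT (fun x => (normal_pdf 0 (a * s) x)%:E).
  by apply/measurable_EFinP; exact: measurable_normal_pdf.
rewrite ge0_integral_mscale//; last 2 first.
- exact: measurable_funS mpdf.
- by move=> x _; rewrite lee_fin normal_pdf_ge0.
rewrite ge0_integral_pushforward//; last 2 first.
- exact: measurable_funS mpdf.
- by move=> x _; rewrite lee_fin normal_pdf_ge0.
have mfB : measurable ((f : _ -> _) @^-1` B).
  by rewrite -[X in measurable X]setTI; apply: (ma measurableT).
rewrite -ge0_integralZl//.
- by apply: eq_integral => y _ /=; rewrite (normal_pdf_scale _ a0 s0).
- apply: measurable_funS (measurableT) _ _ => //.
  exact: measurableT_comp.
- by move=> x _; rewrite lee_fin normal_pdf_ge0.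
Qed.

(** * The bridge equation along a path *)

(** Heine-Cantor: the scale del at which f oscillates by less than e is locally
    uniform on K, and a compact set makes it uniform. *)
Lemma within_unif_continuous (R : realType) (K : set R) (f : R -> R) :
  compact K -> {within K, continuous f} ->
  forall e, 0 < e -> exists2 del, 0 < del &
    forall y z, K y -> K z -> `|y - z| < del -> `|f y - f z| < e.
Proof.
move=> cK /subspace_continuousP cf e e0.
move/compact_near_coveringP : cK => /(_ R 0^'+
  (fun del y => K y -> forall z, K z -> `|y - z| < del -> `|f y - f z| < e)).
case=> [y Ky|del /= del0 H].
  have e20 : 0 < e / 2 by rewrite divr_gt0.
  have := cf _ Ky => /cvgrPdist_lt/(_ _ e20).
  rewrite near_withinE => /nbhs_ballP[eta /= eta0 Heta].
  exists (ball y (eta / 2), [set del | 0 < del < eta / 2]) => /=.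
    split; first by apply: nbhsx_ballx; rewrite divr_gt0.
    have eta20 : 0 < eta / 2 by rewrite divr_gt0.
    near=> del; apply/andP; split; near: del.
    - exact: nbhs_right_gt.
    - exact: nbhs_right_lt.
  move=> [z del] /= [yz /andP[_ deleta]] Kz u Ku zu.
  have fyz : `|f y - f z| < e / 2.
    apply: Heta => //; apply: (le_ball _ yz).
    by move: eta0; lra.
  have fyu : `|f y - f u| < e / 2.
    apply: Heta => //; rewrite /ball/= (splitr eta).
    rewrite (_ : y - u = (y - z) + (z - u)); last by ring.
    by rewrite (le_lt_trans (ler_normD _ _))// ltrD// (lt_trans zu).
  rewrite (_ : f z - f u = (f y - f u) - (f y - f z)); last by ring.
  by rewrite (splitr e) (le_lt_trans (ler_normB _ _))// ltrD.
exists (del / 2); first by rewrite divr_gt0.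
move=> y z Ky Kz yz; apply: (H (del / 2)) => //=.
- by rewrite /ball/= sub0r normrN gtr0_norm ?divr_gt0//; move: del0; lra.
- by rewrite divr_gt0.
Unshelve. all: by end_near. Qed.

Definition grid (R : realType) (a b : R) (n i : nat) : R :=
  a + (b - a) * (i%:R / n%:R).

Section pathwise.
Context (R : realType) (t x0 : R) (x w : R -> R).
Hypothesis cx : {within `[t, 1[, continuous x}.
Hypothesis xE : forall s, t <= s < 1 ->
  x s = x0 - \int[lebesgue_measure]_(u in `[t, s]) (x u / (1 - u)) + (w s - w t).

Let M u := x u / (1 - u).

Lemma within_continuous_ratio b : b < 1 -> {within `[t, b], continuous M}.
Proof.
move=> b1; apply/subspace_continuousP => u /= utb.
have xu : x z @[z --> within `[t, b] (nbhs u)] --> x u.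
  have : {within `[t, b], continuous x}.
    apply: continuous_subspaceW cx => z /=; rewrite !in_itv/= => /andP[-> zb] /=.
    exact: le_lt_trans b1.
  by move/subspace_continuousP; apply.
apply: cvgM => //; apply: cvgV.
  move: utb; rewrite in_itv/= => /andP[_ ub].
  by rewrite subr_eq0 gt_eqF// (le_lt_trans ub).
apply: cvg_within_filter.
by apply: cvgB; [exact: cvg_cst|exact: cvg_id].
Qed.

Lemma integrable_ratio a b : t <= a -> b < 1 ->
  lebesgue_measure.-integrable `[a, b] (EFin \o M).
Proof.
move=> ta b1; apply: continuous_compact_integrable; first exact: segment_compact.
apply: continuous_subspaceW (within_continuous_ratio b1) => z /=.
by rewrite !in_itv/= => /andP[/(le_trans ta)-> ->].
Qed.

Lemma noise_increment a b : t <= a -> a <= b -> b < 1 ->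
  w b - w a = x b - x a + \int[lebesgue_measure]_(u in `[a, b]) M u.
Proof.
move=> ta ab b1.
have a1 := le_lt_trans ab b1.
rewrite (xE (s := a)) ?ta// (xE (s := b)) ?b1 ?(le_trans ta)//.
have := @Rintegral_itvB R M (BLeft t) (BRight b) a.
rewrite !bnd_simp => /(_ (integrable_ratio (lexx _) b1) ta ab).
rewrite Rintegral_itv_obnd_cbnd//; last first.
  apply: integrableS (integrable_ratio ta b1) => //.
  by apply: subset_itvr; rewrite bnd_simp.
by move=> <-; rewrite -/M; ring.
Qed.

(** Since dx = - M du + dw, where M = x / (1 - .), the increment of M over [a, b]
    and (w b - w a) / (1 - b) differ by exactly the integral of M a - M u over
    [a, b], divided by 1 - b: only the oscillation of M enters. *)
Lemma ratio_step (e a b c : R) : t <= a -> a <= b -> b <= c -> c < 1 ->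
  (forall u, a <= u <= b -> `|M a - M u| <= e) ->
  `|M b - M a - (w b - w a) / (1 - b)| <= e * (b - a) / (1 - c).
Proof.
move=> ta ab bc c1 Me.
have b1 := le_lt_trans bc c1; have a1 := le_lt_trans ab b1.
have e0 : 0 <= e by rewrite (le_trans _ (Me a _)) ?lexx.
have iM := integrable_ratio ta b1.
have icst (k : R) : lebesgue_measure.-integrable `[a, b] (EFin \o cst k).
  apply: continuous_compact_integrable; first exact: segment_compact.
  by apply: continuous_subspaceT => ?; exact: cvg_cst.
have lenab : fine (lebesgue_measure (`[a, b] : set R)) = b - a.
  rewrite lebesgue_measure_itv/= lte_fin; case: ltP => //= ba.
  by apply/esym/eqP; rewrite subr_eq0 eq_le ab ba.
have intcst : \int[lebesgue_measure]_(u in `[a, b]) M a = M a * (b - a).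
  by rewrite Rintegral_cst// lenab.
have -> : M b - M a - (w b - w a) / (1 - b) =
    (\int[lebesgue_measure]_(u in `[a, b]) (M a - M u)) / (1 - b).
  rewrite RintegralB//; last exact: icst.
  rewrite intcst noise_increment//.
  rewrite /M.
  by field; rewrite !subr_eq0 !gt_eqF.
have c10 : 0 < 1 - c by rewrite subr_gt0.
rewrite normrM normfV (gtr0_norm (x := 1 - b)) ?subr_gt0//.
apply: ler_pM; rewrite ?normr_ge0 ?invr_ge0 ?subr_ge0 ?(ltW b1)//; last first.
  by rewrite lef_pV2 ?posrE ?subr_gt0// lerD2l lerN2.
have iMM : lebesgue_measure.-integrable `[a, b] (EFin \o (fun u => M a - M u)).
  by have := integrableB _ (icst (M a)) iM; apply.
apply: (le_trans (le_normr_Rintegral _ _)) => //.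
rewrite -lenab -Rintegral_cst//; apply: le_Rintegral => //.
  exact: integrable_norm.
exact: icst.
Qed.

(** This is the pathwise meaning of the fact that M b - M a is the integral of
    dw / (1 - u): the errors of [ratio_step] add up to at most a constant times
    the oscillation of M at the scale of the subdivision. *)
Lemma riemann_noise_cvg a b : t <= a -> a <= b -> b < 1 ->
  \sum_(i < m.+1) (w (grid a b m.+1 i.+1) - w (grid a b m.+1 i))
     / (1 - grid a b m.+1 i.+1) @[m --> \oo] --> M b - M a.
Proof.
move=> ta ab b1; apply/cvgrPdist_le => e e0.
(* the sum of the errors is at most the oscillation times c; the term 1 only
   keeps c positive when a = b *)
pose c := (b - a) / (1 - b) + 1.
have b10 : 0 < 1 - b by rewrite subr_gt0.
have c0 : 0 < c by rewrite ltr_wpDl// divr_ge0 ?subr_ge0// ltW.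
have ec0 : 0 < e / c by rewrite divr_gt0.
have [del del0 Hdel] := within_unif_continuous (@segment_compact R t b)
  (within_continuous_ratio b1) ec0.
near=> m.
set r := grid a b m.+1.
have r0 : r 0%N = a by rewrite /r /grid mul0r mulr0 addr0.
have rm : r m.+1 = b by rewrite /r /grid divff// mulr1 addrC subrK.
have step i : r i.+1 - r i = (b - a) / m.+1%:R.
  by rewrite /r /grid -natr1; field; rewrite addrC natr1 pnatr_eq0.
have rle i j : (i <= j)%N -> r i <= r j.
  move=> ij; rewrite /r /grid lerD2l ler_wpM2l ?subr_ge0//.
  by rewrite ler_pM2r ?invr_gt0// ler_nat.
have -> : M b - M a = \sum_(i < m.+1) (M (r i.+1) - M (r i)).
  by rewrite -(big_mkord xpredT (fun i => M (r i.+1) - M (r i))) telescope_sumr// r0 rm.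
rewrite -sumrB (le_trans (ler_norm_sum _ _ _))//.
apply: (@le_trans _ _ (\sum_(i < m.+1) (e / c * ((b - a) / m.+1%:R) / (1 - b)))).
  apply: ler_sum => i _; rewrite -(step i).
  have ari : a <= r i by rewrite -r0 rle.
  have rib : r i.+1 <= b by rewrite -rm rle.
  apply: ratio_step => //; rewrite ?(le_trans ta)// ?rle// => u /andP[riu uri].
  have au : a <= u by rewrite (le_trans ari).
  have ub : u <= b by rewrite (le_trans uri).
  have rb : r i <= b by rewrite (le_trans riu).
  apply/ltW/Hdel; rewrite /= ?in_itv/= ?ub ?rb ?(le_trans ta)//.
  rewrite distrC ger0_norm ?subr_ge0// (@le_lt_trans _ _ (r i.+1 - r i))//.
    by rewrite lerD2r.
  rewrite step ltr_pdivrMr// mulrC -ltr_pdivrMr//.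
  rewrite (@lt_trans _ _ m%:R) ?ltr_nat//.
  by near: m; exact: nbhs_infty_gtr.
rewrite sumr_const card_ord -[leLHS]mulr_natl.
rewrite (_ : _ * _ = e * (((b - a) / (1 - b)) / c)); last first.
  field; rewrite !gt_eqF// ?ltr0n//.
by rewrite ler_piMr ?(ltW e0)// ler_pdivrMr// mul1r lerDl.
Unshelve. all: by end_near. Qed.

End pathwise.

(** * Optimal stopping of a random walk *)

(** Value at state s and index k, with j transitions left, of stopping a random
    walk with increment laws mu so as to collect g. *)
Fixpoint snell (R : realType) (mu : nat -> set R -> \bar R)
    (g : nat -> R -> \bar R) (j k : nat) (s : R) : \bar R :=
  if j is j'.+1 then
    maxe (g k s) (\int[mu k]_y snell mu g j' k.+1 (s + y))%E
  else g k s.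

Section snell.
Context (R : realType) (mu : nat -> probability R R) (g : nat -> R -> \bar R).
Hypothesis mg : forall k, measurable_fun setT (g k).
Hypothesis g0 : forall k s, (0 <= g k s)%E.

Lemma snell_ge0 j k s : (0 <= snell mu g j k s)%E.
Proof. by case: j => [|j] /=; rewrite ?le_max g0. Qed.

Lemma measurable_translate_integral (phi : R -> \bar R) k :
  measurable_fun setT phi -> (forall s, 0 <= phi s)%E ->
  measurable_fun setT (fun s : R => \int[mu k]_y phi (s + y)%R)%E.
Proof.
move=> mphi phi0.
apply: (@measurable_fun_fubini_tonelli_F _ _ R R R (mu k)
  (fun z => phi (z.1 + z.2))) => //.
by apply: measurableT_comp => //; exact: measurable_funD.
Qed.

Lemma measurable_snell j k : measurable_fun setT (snell mu g j k).
Proof.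
elim: j k => [|j IH] k /=; first exact: mg.
apply: measurable_maxe; first exact: mg.
by apply: measurable_translate_integral => // s; exact: snell_ge0.
Qed.

End snell.

Lemma measurable_random_index (R : realType) (d : measure_display)
    (T : measurableType d) (X : nat -> T -> \bar R) (kappa : T -> nat) :
  (forall k, measurable_fun setT (X k)) ->
  (forall k, measurable [set w | (kappa w <= k)%N]) ->
  measurable_fun setT (fun w => X (kappa w) w).
Proof.
move=> mX mk _ B mB; rewrite setTI.
have mkE k : measurable [set w | kappa w = k].
  case: k => [|k].
    rewrite (_ : [set _ | _] = [set w | (kappa w <= 0)%N]); first exact: mk.
    by apply/seteqP; split => w /=; rewrite leqn0 => /eqP.
  rewrite (_ : [set _ | _] = [set w | (kappa w <= k.+1)%N] `\` [set w | (kappa w <= k)%N]).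
    by apply: measurableD.
  apply/seteqP; split => w /=; first by move=> ->; rewrite leqnn ltnn.
  by move=> [h1 /negP]; rewrite -ltnNge => h2; apply/eqP; rewrite eqn_leq h1.
rewrite (_ : _ @^-1` _ = \bigcup_k ([set w | kappa w = k] `&` X k @^-1` B)).
  apply: bigcupT_measurable => k; apply: measurableI => //.
  by rewrite -[X in measurable X]setTI; exact: mX.
apply/seteqP; split => w /=; first by move=> Bw; exists (kappa w).
by move=> [k _ [/= ->]].
Qed.

Section random_walk.
Context (R : realType) (d : measure_display) (Omega : measurableType d).
Variables (P : probability Omega R) (G : nat -> set (set Omega)).
Variables (S : nat -> Omega -> R) (mu : nat -> probability R R).
Variable g : nat -> R -> \bar R.
Hypothesis sG : forall k, <<s G k>> `<=` measurable.
Hypothesis ndG : forall i j, (i <= j)%N -> <<s G i>> `<=` <<s G j>>.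
Hypothesis mS : forall k,
  measurable_fun setT (S k : g_sigma_algebraType (G k) -> R).
Hypothesis incS : forall k A, <<s G k>> A -> forall B, measurable B ->
  P (A `&` (fun w => S k.+1 w - S k w) @^-1` B) = (P A * mu k B)%E.
Hypothesis mg : forall k, measurable_fun setT (g k).
Hypothesis g0 : forall k s, (0 <= g k s)%E.

Local Notation V := (snell mu g).

Lemma walk_measurable k : measurable_fun setT (S k).
Proof.
move=> _ B mB; rewrite setTI; apply: (sG (k := k)).
by rewrite -[X in _ X]setTI; exact: mS.
Qed.

Lemma walk_adapted k (B : set R) : measurable B -> <<s G k>> (S k @^-1` B).
Proof. by move=> mB; rewrite -[X in _ X]setTI; exact: mS. Qed.

(** The next state is the present one plus an increment independent of the
    past, so the increment can be integrated out while the past is frozen. *)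
Lemma walk_markov k A (phi : R -> \bar R) :
  <<s G k>> A -> measurable_fun setT phi -> (forall s, 0 <= phi s)%E ->
  (\int[P]_(w in A) phi (S k.+1 w) =
   \int[P]_(w in A) \int[mu k]_y phi (S k w + y)%R)%E.
Proof.
move=> GA mphi phi0.
have mD : measurable_fun setT (fun w => S k.+1 w - S k w).
  by apply: measurable_funB; exact: walk_measurable.
pose f (z : g_sigma_algebraType (G k) * R) : \bar R :=
  ((\1_A z.1)%:E * phi (S k z.1 + z.2)%R)%E.
have mA : measurable (A : set (g_sigma_algebraType (G k))) by [].
have mf : measurable_fun setT f.
  apply: emeasurable_funM.
    apply/measurable_EFinP; apply: measurableT_comp => //.
  apply: measurableT_comp => //; apply: measurable_funD => //.
  exact: measurableT_comp.
have f0 z : (0 <= f z)%E by rewrite mule_ge0.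
have := freezing (sG (k := k)) mD (incS (k := k)) mf f0.
rewrite /f /=; under eq_integral do rewrite subrKC.
move=> H; transitivity (\int[P]_w ((\1_A w)%:E * phi (S k.+1 w)))%E.
  rewrite integral_mkcond epatch_indic.
  by apply: eq_integral => w _; rewrite /= muleC.
rewrite H [RHS]integral_mkcond epatch_indic.
apply: eq_integral => w _ /=; rewrite muleC ge0_integralZl//.
by apply: measurableT_comp => //; exact: measurable_funD.
Qed.

Lemma sub_filtration k (A : set Omega) : <<s G k>> A -> measurable A.
Proof. exact: sG. Qed.

Lemma filtrationI k (A B : set Omega) :
  <<s G k>> A -> <<s G k>> B -> <<s G k>> (A `&` B).
Proof.
exact: (@measurableI _ (g_sigma_algebraType (G k))).
Qed.

Lemma filtrationD k (A B : set Omega) :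
  <<s G k>> A -> <<s G k>> B -> <<s G k>> (A `\` B).
Proof.
exact: (@measurableD _ (g_sigma_algebraType (G k))).
Qed.

Lemma measurable_stopped_payoff (kappa : Omega -> nat) :
  (forall i, <<s G i>> [set w | (kappa w <= i)%N]) ->
  measurable_fun setT (fun w => g (kappa w) (S (kappa w) w)).
Proof.
move=> mk; apply: (measurable_random_index (X := fun i w => g i (S i w))).
  by move=> k; apply: measurableT_comp => //; exact: walk_measurable.
by move=> k; exact: sub_filtration (mk k).
Qed.

Lemma measurable_snell_walk j k : measurable_fun setT (fun w => V j k (S k w)).
Proof. by apply: measurableT_comp; [exact: measurable_snell|exact: walk_measurable]. Qed.

Lemma integral_split (A B : set Omega) (f : Omega -> \bar R) :
  measurable A -> measurable B -> measurable_fun setT f ->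
  (forall w, 0 <= f w)%E ->
  (\int[P]_(w in A) f w =
   \int[P]_(w in A `&` B) f w + \int[P]_(w in A `\` B) f w)%E.
Proof.
move=> mA mB mf f0; rewrite -ge0_integral_setU//.
- by rewrite setUIDK.
- exact: measurableI.
- exact: measurableD.
- exact: measurable_funS mf.
- by apply/disj_setPS => w [[_ ?] [_]].
Qed.

(** Split A according to whether kappa stops at k: where it stops, the payoff is
    one of the two terms of the maximum; where it goes on, the induction
    hypothesis bounds the payoff by the value at k.+1, whose conditional
    expectation is the other term. *)
Lemma stopped_payoff_le_snell (kappa : Omega -> nat) j k A :
  (forall i, <<s G i>> [set w | (kappa w <= i)%N]) -> <<s G k>> A ->
  (forall w, A w -> (k <= kappa w <= k + j)%N) ->
  (\int[P]_(w in A) g (kappa w) (S (kappa w) w) <=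
   \int[P]_(w in A) V j k (S k w))%E.
Proof.
move=> mkappa; have mg_kappa := measurable_stopped_payoff mkappa.
elim: j k A => [|j IH] k A GA Akappa.
  rewrite le_eqVlt; apply/orP; left; apply/eqP/eq_integral => w.
  rewrite inE => /Akappa; rewrite addn0 => kk.
  by have -> : kappa w = k by apply/eqP; rewrite eqn_leq andbC.
pose B := [set w | (kappa w <= k)%N].
have GB : <<s G k>> B by exact: mkappa.
have mA := sub_filtration GA; have mB := sub_filtration GB.
have mV := measurable_snell_walk j.+1 k.
have GAB := filtrationI GA GB; have GADB := filtrationD GA GB.
have mAB := sub_filtration GAB; have mADB := sub_filtration GADB.
rewrite (integral_split mA mB)//.
rewrite (integral_split mA mB (f := fun w => V j.+1 k (S k w)))//; last first.
  by move=> w; exact: snell_ge0.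
apply: leeD.
  apply: ge0_le_integral => //.
  - exact: measurable_funS mg_kappa.
  - exact: measurable_funS mV.
  - move=> w [/Akappa/andP[kk _] kB].
    have -> : kappa w = k by apply/eqP; rewrite eqn_leq kB kk.
    by rewrite /= le_max lexx.
apply: (@le_trans _ _ (\int[P]_(w in A `\` B) V j k.+1 (S k.+1 w))%E).
  apply: IH; first exact: (ndG (i := k)).
  move=> w [/Akappa/andP[_]]; rewrite addnS addSn => -> /negP.
  by rewrite -ltnNge => ->.
rewrite (walk_markov GADB (measurable_snell mu mg g0 j k.+1))//; last first.
  by move=> s; exact: snell_ge0.
apply: ge0_le_integral => //.
- by move=> w _; apply: integral_ge0 => y _; exact: snell_ge0.
- have m1 := measurable_translate_integral mu k (measurable_snell mu mg g0 j k.+1)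
    (snell_ge0 mu g0 j k.+1).
  apply: (measurable_funS (E := setT)) => //.
  apply: (measurableT_comp m1); exact: walk_measurable.
- exact: measurable_funS mV.
- by move=> w _; rewrite /= le_max lexx orbT.
Qed.

(** The optimal rule: stop as soon as the value equals the payoff.  On the event
    that it goes on, the maximum defining [snell] is its second term. *)
Fixpoint first_contact (j k : nat) (w : Omega) : nat :=
  if j is j'.+1 then
    if V j k (S k w) == g k (S k w) then k else first_contact j' k.+1 w
  else k.

Lemma first_contact_ge j k w : (k <= first_contact j k w)%N.
Proof.
elim: j k => [|j IH] k //=; case: ifP => // _.
by rewrite (leq_trans _ (IH _)).
Qed.

Lemma first_contact_le j k w : (first_contact j k w <= k + j)%N.
Proof.
elim: j k => [|j IH] k /=; first by rewrite addn0.
by case: ifP => _; [exact: leq_addr|rewrite -addSnnS].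
Qed.

Lemma contact_adapted j k : <<s G k>> [set w | V j k (S k w) = g k (S k w)].
Proof.
apply: (walk_adapted (B := [set s | V j k s = g k s])).
rewrite -[X in measurable X]setTI; apply: measurable_eqe => //.
exact: measurable_snell.
Qed.

Lemma first_contact_stopping j k i :
  <<s G i>> [set w | (first_contact j k w <= i)%N].
Proof.
pose mT := @measurableT _ (g_sigma_algebraType (G i)).
pose m0 := @measurable0 _ (g_sigma_algebraType (G i)).
have [ki|ik] := leqP k i; last first.
  rewrite [X in _ X](_ : _ = set0); first exact: m0.
  apply/seteqP; split => // w /= h.
  by have := leq_ltn_trans (leq_trans (first_contact_ge j k w) h) ik; rewrite ltnn.
elim: j k ki => [|j IH] k ki.
  by rewrite [X in _ X](_ : _ = setT); [exact: mT|apply/seteqP; split].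
have [ki1|] := ltnP k i; last first.
  move=> ik; have {ik}ki' : k = i by apply/eqP; rewrite eqn_leq ki ik.
  rewrite -ki'; rewrite [X in _ X](_ : _ = [set w | V j.+1 k (S k w) = g k (S k w)]).
    exact: contact_adapted.
  apply/seteqP; split => w /=.
    case: ifPn => [/eqP //|_ h].
    by have := leq_trans (first_contact_ge j k.+1 w) h; rewrite ltnn.
  by move=> ->; rewrite eqxx.
rewrite [X in _ X](_ : _ = [set w | V j.+1 k (S k w) = g k (S k w)] `|`
    [set w | (first_contact j k.+1 w <= i)%N]).
  apply: (@measurableU _ (g_sigma_algebraType (G i))).
    by apply: (ndG ki); exact: contact_adapted.
  exact: IH.
apply/seteqP; split => w /=.
  by case: ifPn => [/eqP|]; [left|right].
case: ifPn => [//|/eqP h [//|]].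
by [].
Qed.

Lemma snell_attained j k A : <<s G k>> A ->
  (\int[P]_(w in A) V j k (S k w) =
   \int[P]_(w in A) g (first_contact j k w) (S (first_contact j k w) w))%E.
Proof.
elim: j k A => [//|j IH] k A GA.
pose B := [set w | V j.+1 k (S k w) = g k (S k w)].
have GB : <<s G k>> B by exact: contact_adapted.
have mA := sub_filtration GA; have mB := sub_filtration GB.
have GADB := filtrationD GA GB.
rewrite (integral_split mA mB)//; last 2 first.
- exact: measurable_snell_walk.
- by move=> w; exact: snell_ge0.
rewrite (integral_split mA mB (f := fun w => g _ (S (first_contact j.+1 k w) w)))//; last first.
  by apply: measurable_stopped_payoff; exact: first_contact_stopping.
congr (_ + _)%E.
  apply: eq_integral => w; rewrite inE => -[_ Bw].
  by rewrite [in RHS]/= [X in if X then _ else _](_ : _ = true) //; apply/eqP.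
have off w : w \in A `\` B -> (V j.+1 k (S k w) == g k (S k w)) = false.
  by rewrite inE => -[_ nB]; apply/negP => /eqP.
transitivity (\int[P]_(w in A `\` B) \int[mu k]_y V j k.+1 (S k w + y)%R)%E.
  apply: eq_integral => w /off /=.
  by rewrite maxEle; case: ifP => // _; rewrite eqxx.
rewrite -(walk_markov GADB (measurable_snell mu mg g0 j k.+1))//; last first.
  by move=> s; exact: snell_ge0.
rewrite IH; last exact: (ndG (i := k)).
by apply: eq_integral => w /off /= ->.
Qed.

End random_walk.

(** * Convexity in the volatility *)

(** In the time scale u and with the volatility c the bridge is
    (1 - u) (x + c s), where s is the state of the driving walk. *)
Definition bridge_payoff (R : realType) (u : nat -> R) (x c : R) (k : nat)
    (s : R) : \bar R :=
  (expR ((1 - u k) * (x + c * s)))%:E.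

Section volatility.
Context (R : realType) (mu : nat -> probability R R) (u : nat -> R) (x : R).
Hypothesis u_nd : forall k, u k <= u k.+1.
Hypothesis x_ge0 : 0 <= x.

Lemma measurable_bridge_payoff c k : measurable_fun setT (bridge_payoff u x c k).
Proof.
apply/measurable_EFinP; apply: measurableT_comp => //.
by apply: measurable_funM => //; apply: measurable_funD => //; exact: measurable_funM.
Qed.

Lemma bridge_payoff_ge0 c k s : (0 <= bridge_payoff u x c k s)%E.
Proof. by rewrite lee_fin expR_ge0. Qed.

(** Convexity of the value in the volatility, between 0 and c.  With volatility
    0 and x >= 0 the payoff decreases in time, so that stopping at once is
    optimal: this is why the first term is that of index k and why it absorbs
    the one produced at index k.+1. *)
Lemma snell_volatility_convex (c l : R) j k s : 0 <= l <= 1 ->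
  (snell mu (bridge_payoff u x (l * c)) j k s <=
   ((1 - l) * expR ((1 - u k) * x))%:E +
   l%:E * snell mu (bridge_payoff u x c) j k s)%E.
Proof.
move=> l01; have /andP[l0 l1] := l01.
have l10 : 0 <= 1 - l by rewrite subr_ge0.
have payoff k' s' : (bridge_payoff u x (l * c) k' s' <=
   ((1 - l) * expR ((1 - u k') * x))%:E + l%:E * bridge_payoff u x c k' s')%E.
  rewrite /bridge_payoff -EFinM -EFinD lee_fin [leRHS]addrC.
  have conv (a b : R) :
      expR (l * a + (1 - l) * b) <= l * expR a + (1 - l) * expR b.
    by have := convex_expR (Itv01 l0 l1) a b; rewrite !convRE.
  apply: le_trans (conv _ _).
  by rewrite ler_expR le_eqVlt; apply/orP; left; apply/eqP; ring.
elim: j k s => [|j IH] k s; first by apply: payoff.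
rewrite [leLHS]/= ge_max; apply/andP; split.

  apply: (le_trans (payoff k s)); rewrite leeD2l// lee_wpmul2l ?lee_fin//=.
  by rewrite le_max lexx.
pose phi y := snell mu (bridge_payoff u x c) j k.+1 (s + y).
have phi0 y : (0 <= phi y)%E by apply: snell_ge0; exact: bridge_payoff_ge0.
have mphi : measurable_fun setT phi.
  apply: measurableT_comp; last exact: measurable_funD.
  exact: measurable_snell (measurable_bridge_payoff c) (bridge_payoff_ge0 c) _ _.
have e0 : 0 <= (1 - l) * expR ((1 - u k.+1) * x) by rewrite mulr_ge0 ?expR_ge0.
apply: (@le_trans _ _ (\int[mu k]_y
    (((1 - l) * expR ((1 - u k.+1) * x))%:E + l%:E * phi y))%E).
  apply: ge0_le_integral => //.
  - by move=> y _; apply: snell_ge0; exact: bridge_payoff_ge0.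
  - apply: measurableT_comp; last exact: measurable_funD.
    exact: measurable_snell (measurable_bridge_payoff _) (bridge_payoff_ge0 _) _ _.
  - by apply: emeasurable_funD => //; exact: measurable_funeM.
have lphi0 y : (0 <= l%:E * phi y)%E by rewrite mule_ge0 ?lee_fin.
rewrite ge0_integralD//; last exact: measurable_funeM.
rewrite integral_probability_cst ge0_integralZl//.
apply: leeD.
  by rewrite lee_fin ler_wpM2l// ler_expR ler_wpM2r// lerD2l lerN2.
by rewrite lee_wpmul2l ?lee_fin//= le_max lexx orbT.
Qed.

Lemma snell_volatility_gt (c c' : R) j : 0 <= c' <= c -> 0 < c -> u 0%N = 0 ->
  ((expR x)%:E < snell mu (bridge_payoff u x c') j 0%N 0)%E ->
  ((expR x)%:E < snell mu (bridge_payoff u x c) j 0%N 0)%E.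
Proof.
move=> /andP[c'0 c'c] c0 u0.
pose l := c' / c.
have l01 : 0 <= l <= 1 by rewrite divr_ge0 ?(ltW c0)//= ler_pdivrMr// mul1r.
have /andP[l0 l1] := l01.
have -> : c' = l * c by rewrite /l divfK// gt_eqF.
move=> /lt_le_trans /(_ (snell_volatility_convex c j 0%N 0 l01)).
rewrite u0 subr0 mul1r; apply: contraTT; rewrite -!leNgt => Vx.
apply: (@le_trans _ _ (((1 - l) * expR x)%:E + l%:E * (expR x)%:E)%E).
  by rewrite leeD2l// lee_wpmul2l ?lee_fin.
by rewrite -EFinM -EFinD lee_fin -mulrDl subrK mul1r.
Qed.

End volatility.

(** * Sums of independent increments *)

Definition independent_increments (R : realType) (d : measure_display)
    (Omega : measurableType d) (P : probability Omega R)
    (G : nat -> set (set Omega)) (xi : nat -> Omega -> R) : Prop :=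
  [/\ forall i, <<s G i>> `<=` measurable,
      forall i, <<s G i>> `<=` <<s G i.+1>>,
      forall i, measurable_fun setT (xi i : g_sigma_algebraType (G i.+1) -> R)
    & forall i A, <<s G i>> A -> forall B, measurable B ->
        P (A `&` xi i @^-1` B) = (P A * P (xi i @^-1` B))%E].

Definition partial_sum (R : realType) (Omega : Type) (xi : nat -> Omega -> R)
    (p : nat) (w : Omega) : R :=
  \sum_(i < p) xi i w.

Section sum_laws.
Context (R : realType) (d : measure_display) (Omega : measurableType d).
Variable P : probability Omega R.

Lemma increment_measurable G (xi : nat -> Omega -> R) i :
  independent_increments P G xi -> measurable_fun setT (xi i).
Proof.
by move=> [sG _ mxi _] _ B mB; rewrite setTI; apply: (sG i.+1);
  rewrite -[X in _ X]setTI; exact: mxi.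
Qed.

Lemma partial_sum_adapted G (xi : nat -> Omega -> R) p :
  independent_increments P G xi ->
  measurable_fun setT
    (partial_sum xi p : g_sigma_algebraType (G p) -> R).
Proof.
move=> [sG ndG mxi _]; elim: p => [|p IH].
  rewrite (_ : partial_sum _ _ = cst 0); first exact: measurable_cst.
  by apply/funext => w; rewrite /partial_sum big_ord0.
rewrite (_ : partial_sum _ _ = (fun w => partial_sum xi p w + xi p w)).
  apply: measurable_funD => //.
  move=> _ B mB; rewrite setTI; apply: (ndG p).
  by rewrite -[X in _ X]setTI; exact: IH.
by apply/funext => w; rewrite /partial_sum big_ord_recr.
Qed.

Lemma partial_sum_measurable G (xi : nat -> Omega -> R) p :
  independent_increments P G xi -> measurable_fun setT (partial_sum xi p).
Proof.
move=> iG; have [sG _ _ _] := iG.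
move=> _ B mB; rewrite setTI; apply: (sG p); rewrite -[X in _ X]setTI.
exact: (partial_sum_adapted (p := p) iG).
Qed.

(** Two sums of independent increments with the same laws have the same law; the
    factor P A records, in the same induction, that the first sum is
    independent of the initial sigma-algebra. *)
Lemma partial_sum_law G G0 (xi xi0 : nat -> Omega -> R) p :
  independent_increments P G xi -> independent_increments P G0 xi0 ->
  (forall i, (i < p)%N -> forall B, measurable B ->
    P (xi i @^-1` B) = P (xi0 i @^-1` B)) ->
  forall A, <<s G 0%N>> A -> forall B, measurable B ->
    P (A `&` partial_sum xi p @^-1` B) =
    (P A * P (partial_sum xi0 p @^-1` B))%E.
Proof.
move=> iG iG0; have [sG ndG _ indG] := iG; have [sG0 _ _ indG0] := iG0.
elim: p => [|p IH] law A GA B mB.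
  have cst0 (f : nat -> Omega -> R) : partial_sum f 0 = cst 0.
    by apply/funext => w; rewrite /partial_sum big_ord0.
  rewrite !cst0 !preimage_cst; case: ifP => _.
    by rewrite setIT probability_setT mule1.
  by rewrite setI0 measure0 mule0.
have {}IH := IH (fun i ip => law i (ltnW ip)).
have mA : measurable A by exact: (sG 0%N).
have GpA : <<s G p>> A.
  have nd q : <<s G 0%N>> `<=` <<s G q>>.
    by elim: q => // q IHq; apply: subset_trans IHq (ndG q).
  exact: nd.
have PA_ge0 : 0 <= fine (P A) by exact: fine_ge0.
pose k : {nonneg R} := NngNum PA_ge0.
have kE : k%:num%:E = P A by rewrite /= fineK// fin_num_measure.
have sumE (f : nat -> Omega -> R) : partial_sum f p.+1 = partial_sum f p \+ f p.
  by apply/funext => w; rewrite /partial_sum big_ord_recr.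
have := @law_add_unique R _ _ Omega Omega (mrestr P mA) (mscale k P)
  (partial_sum xi p) (xi p) (partial_sum xi0 p) (xi0 p).
rewrite !sumE; move=> H.
have : mrestr P mA ((partial_sum xi p \+ xi p) @^-1` B) =
       mscale k P ((partial_sum xi0 p \+ xi0 p) @^-1` B).
  have mxi q := increment_measurable q iG; have mxi0 q := increment_measurable q iG0.
  have mpx := partial_sum_measurable p iG; have mpx0 := partial_sum_measurable p iG0.
  apply: H => //.
  move=> C D mC mD.
  have GC : <<s G p>> (A `&` partial_sum xi p @^-1` C).
    apply: (@measurableI _ (g_sigma_algebraType (G p))) => //.
    by rewrite -[X in measurable X]setTI; exact: (partial_sum_adapted (p := p) iG).
  have G0C : <<s G0 p>> (partial_sum xi0 p @^-1` C).
    by rewrite -[X in _ X]setTI; exact: (partial_sum_adapted (p := p) iG0).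
  rewrite -[LHS]/(P ((partial_sum xi p @^-1` C `&` xi p @^-1` D) `&` A)).
  rewrite -[RHS]/(k%:num%:E * P (partial_sum xi0 p @^-1` C `&` xi0 p @^-1` D))%E kE.
  rewrite (setIC _ A) setIA indG// IH// indG0// -muleA; congr (_ * (_ * _))%E.
  exact: law.
by rewrite /mrestr /mscale kE (setIC _ A).
Qed.

(** [law_limit] for the restriction of P to A on one side and the multiple of P
    by P A on the other. *)
Lemma limit_law (A : set Omega) (f g : (Omega -> R)^nat) (f' g' : Omega -> R) :
  measurable A ->
  (forall n, measurable_fun setT (f n)) ->
  (forall n, measurable_fun setT (g n)) ->
  measurable_fun setT f' -> measurable_fun setT g' ->
  {ae P, forall w, f ^~ w @ \oo --> f' w} ->
  {ae P, forall w, g ^~ w @ \oo --> g' w} ->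
  (forall n B, measurable B ->
    P (A `&` f n @^-1` B) = (P A * P (g n @^-1` B))%E) ->
  forall B, measurable B -> P (A `&` f' @^-1` B) = (P A * P (g' @^-1` B))%E.
Proof.
move=> mA mf mg mf' mg' ff' gg' fg B mB.
have PA_ge0 : 0 <= fine (P A) by exact: fine_ge0.
pose k : {nonneg R} := NngNum PA_ge0.
have kE : k%:num%:E = P A by rewrite /= fineK// fin_num_measure.
rewrite -kE (setIC A).
apply: (@law_limit R _ _ Omega Omega (mrestr P mA) (mscale k P) f g f' g'
  mf mg mf' mg' _ _ _ B mB).
- have [N [mN N0 sub]] := ff'; exists N; split => //.
  apply/eqP; rewrite -measure_le0 -N0 /mrestr; apply: le_measure; rewrite ?inE//.
  exact: measurableI.
- have [N [mN N0 sub]] := gg'; exists N; split => //.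
  by rewrite -[LHS]/(k%:num%:E * P N)%E N0 mule0.
- move=> n C mC; rewrite -[LHS]/(P (f n @^-1` C `&` A)).
  rewrite -[RHS]/(k%:num%:E * P (g n @^-1` C))%E kE (setIC _ A).
  exact: fg.
Qed.

End sum_laws.

(** * Weighted Brownian increments *)

Definition augmentation (R : realType) (d : measure_display)
    (Omega : measurableType d) (P : probability Omega R)
    (W : R -> Omega -> R) (s : R) : set (set Omega) :=
  natural_filtration W s `|` [set N | P.-negligible N].

Definition rescale (R : realType) (t rho : R) : R := t + (1 - t) * rho.

Section brownian.
Context (R : realType) (d : measure_display) (Omega : measurableType d).
Variables (P : probability Omega R) (W : R -> Omega -> R).
Hypothesis cP : measure_is_complete P.
Hypothesis bmW : standard_brownian_motion P W.

Local Notation F := (augmentation P W).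

Lemma natural_filtration_measurable s : natural_filtration W s `<=` measurable.
Proof.
have [mW _ _ _ _] := bmW.
apply: smallest_sub; first exact: sigma_algebra_measurable.
move=> A [u /=]; rewrite in_itv/= => /andP[u0 _] [B mB <-].
exact: mW.
Qed.

Lemma filtration_measurable s : <<s F s>> `<=` measurable.
Proof. by apply: augmentation_measurable => //; exact: natural_filtration_measurable. Qed.

Lemma filtration_nd r s : r <= s -> <<s F r>> `<=` <<s F s>>.
Proof.
move=> rs; apply: sub_sigma_algebra2 => A [nA|?]; [left|by right].
apply: sub_sigma_algebra2 nA => B [u /= ur mB]; exists u => //=.
by move: ur; rewrite !in_itv/= => /andP[-> /le_trans]; apply.
Qed.

Lemma brownian_adapted r s : 0 <= r <= s ->
  measurable_fun setT (W r : g_sigma_algebraType (F s) -> R).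
Proof.
move=> /andP[r0 rs] _ B mB; rewrite setTI.
apply: sub_sigma_algebra; left; apply: sub_sigma_algebra.
by exists r; [rewrite /= in_itv/= r0|exists B => //; rewrite setTI].
Qed.

Lemma brownian_increment_measurable r s : 0 <= r -> 0 <= s ->
  measurable_fun setT (fun w => W s w - W r w).
Proof.
by have [mW _ _ _ _] := bmW; move=> r0 s0; apply: measurable_funB; exact: mW.
Qed.

Lemma brownian_increment_indep r s A (B : set R) : 0 <= r -> r < s ->
  <<s F r>> A -> measurable B ->
  P (A `&` (fun w => W s w - W r w) @^-1` B) =
  (P A * P ((fun w => (W s w - W r w)%R) @^-1` B))%E.
Proof.
move=> r0 rs FA mB; have [_ _ _ _ indep] := bmW.
apply: (augmentation_indep cP _ _ _ _ FA).
- exact: smallest_sigma_algebra.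
- exact: natural_filtration_measurable.
- rewrite -[X in measurable X]setTI.
  by apply: brownian_increment_measurable => //; rewrite (le_trans r0)// ltW.
- by move=> A' nA'; exact: indep.
Qed.

Lemma weighted_increments (r a : nat -> R) :
  (forall i, 0 <= r i) -> (forall i, r i < r i.+1) ->
  independent_increments P (fun i => F (r i))
    (fun i w => a i * (W (r i.+1) w - W (r i) w)).
Proof.
move=> r0 rS; split.
- by move=> i; exact: filtration_measurable.
- by move=> i; apply: filtration_nd; exact/ltW.
- move=> i; apply: measurable_funM => //; apply: measurable_funB.
  + by apply: brownian_adapted; rewrite r0 lexx.
  + by apply: brownian_adapted; rewrite r0 ltW.
- move=> i A FA B mB.
  have maB : measurable ((fun y => a i * y) @^-1` B).
    by rewrite -[X in measurable X]setTI; exact: measurable_funM.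
  exact: (brownian_increment_indep (r0 i) (rS i) FA maB).
Qed.

(** A Brownian increment over a time (1 - t) (rho' - rho) has standard deviation
    sqrt (1 - t) sqrt (rho' - rho), and the weight contributes
    1 / (sqrt (1 - t) (1 - rho')): the two powers of 1 - t cancel. *)
Lemma rescaled_noise_law (t rho rho' : R) (B : set R) : 0 <= t < 1 ->
  0 <= rho -> rho < rho' -> rho' < 1 -> measurable B ->
  P ((fun w => Num.sqrt (1 - t) / (1 - rescale t rho') *
        (W (rescale t rho') w - W (rescale t rho) w)) @^-1` B) =
  normal_prob 0 (Num.sqrt (rho' - rho) / (1 - rho')) B.
Proof.
move=> /andP[t0 t1] rho0 rhorho' rho'1 mB; have [_ _ _ law _] := bmW.
have c0 : 0 < 1 - t by rewrite subr_gt0.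
have e0 : 0 < 1 - rho' by rewrite subr_gt0.
have dr : rescale t rho' - rescale t rho = (1 - t) * (rho' - rho).
  by rewrite /rescale; ring.
have er : 1 - rescale t rho' = (1 - t) * (1 - rho') by rewrite /rescale; ring.
have lt_r : rescale t rho < rescale t rho' by rewrite -subr_gt0 dr mulr_gt0// subr_gt0.
have r0 : 0 <= rescale t rho by rewrite addr_ge0// mulr_ge0// ltW.
set a := Num.sqrt (1 - t) / _.
have a0 : 0 < a by rewrite /a er divr_gt0 ?sqrtr_gt0// mulr_gt0.
have maB : measurable ((fun y => a * y) @^-1` B).
  by rewrite -[X in measurable X]setTI; exact: measurable_funM.
have /= := law _ _ r0 lt_r _ maB.
have sd0 : 0 < Num.sqrt ((1 - t) * (rho' - rho)).
  by rewrite sqrtr_gt0 mulr_gt0// subr_gt0.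
rewrite dr (normal_prob_scale a0 sd0 mB).
have -> : a * Num.sqrt ((1 - t) * (rho' - rho)) = Num.sqrt (rho' - rho) / (1 - rho').
  rewrite /a er sqrtrM ?(ltW c0)//.
  rewrite -[in X in _ / (X * _)](sqr_sqrtr (ltW c0)); field.
  by rewrite !gt_eqF ?sqrtr_gt0.
by [].
Qed.

End brownian.

(** * Increments of the scaled bridge *)

(** In terms of Z_u = \int_0^u dB_r / (1 - r), where B is the rescaled Brownian
    motion after t, this is the increment of Z over [rho, rho'], read off the
    bridge Y started at time t. *)
Definition scaled_increment (R : realType) (Omega : Type) (t rho rho' : R)
    (Y : R -> Omega -> R) (w : Omega) : R :=
  Num.sqrt (1 - t) * (Y (rescale t rho') w / (1 - rescale t rho')
                      - Y (rescale t rho) w / (1 - rescale t rho)).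

Lemma rescale_itv (R : realType) (t rho : R) :
  0 <= t < 1 -> 0 <= rho < 1 -> t <= rescale t rho < 1.
Proof.
move=> /andP[t0 t1] /andP[rho0 rho1]; rewrite /rescale lerDl mulr_ge0 ?subr_ge0 ?(ltW t1)//=.
by rewrite -ltrBrDl gtr_pMr ?subr_gt0.
Qed.

Lemma rescale_nd (R : realType) (t rho rho' : R) :
  t < 1 -> rho <= rho' -> rescale t rho <= rescale t rho'.
Proof. by move=> t1 h; rewrite lerD2l ler_wpM2l// subr_ge0 ltW. Qed.

Section bridge.
Context (R : realType) (d : measure_display) (Omega : measurableType d).
Variables (P : probability Omega R) (W : R -> Omega -> R).
Hypothesis cP : measure_is_complete P.
Hypothesis bmW : standard_brownian_motion P W.

Local Notation F := (augmentation P W).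

Lemma bridge_adapted t x (Y : R -> Omega -> R) s : brownian_bridge P W t x Y ->
  t <= s < 1 -> measurable_fun setT (Y s : g_sigma_algebraType (F s) -> R).
Proof. by move=> [aY _ _ _] ts _ B mB; rewrite setTI; exact: aY. Qed.

Lemma bridge_measurable t x (Y : R -> Omega -> R) s : brownian_bridge P W t x Y ->
  t <= s < 1 -> measurable_fun setT (Y s).
Proof.
move=> bY ts _ B mB; apply: (filtration_measurable cP bmW (s := s)).
exact: (bridge_adapted bY ts).
Qed.

Let noise (t rho rho' : R) (n i : nat) (w : Omega) : R :=
  let r i := rescale t (grid rho rho' n.+1 i) in
  Num.sqrt (1 - t) / (1 - r i.+1) * (W (r i.+1) w - W (r i) w).

Let noise_cvg t x Y rho rho' : 0 <= t < 1 -> brownian_bridge P W t x Y ->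
  0 <= rho -> rho < rho' -> rho' < 1 ->
  {ae P, forall w, partial_sum (noise t rho rho' n) n.+1 w @[n --> \oo] -->
                   scaled_increment t rho rho' Y w}.
Proof.
move=> t01 [_ cY eY _] rho0 rr' r'1; have /andP[t0 t1] := t01.
apply: filterS2 cY eY => w cYw eYw.
have /andP[tr _] : t <= rescale t rho < 1.
  by rewrite rescale_itv// rho0 (lt_trans rr').
have /andP[_ r1] : t <= rescale t rho' < 1.
  by rewrite rescale_itv// r'1 (le_trans rho0)// ltW.
have H := riemann_noise_cvg cYw eYw tr (rescale_nd t1 (ltW rr')) r1.
apply: cvg_trans (cvgM (cvg_cst (Num.sqrt (1 - t))) H).
apply: near_eq_cvg; apply: nearW => n /=.
rewrite /partial_sum /noise mulr_sumr; apply: eq_bigr => i _.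
have gridE k : grid (rescale t rho) (rescale t rho') n.+1 k =
    rescale t (grid rho rho' n.+1 k) by rewrite /grid /rescale; ring.
by rewrite !gridE; ring.
Qed.

Let noise_indep t rho rho' n : 0 <= t < 1 -> 0 <= rho -> rho < rho' ->
  independent_increments P (fun i => F (rescale t (grid rho rho' n.+1 i)))
    (noise t rho rho' n).
Proof.
move=> /andP[t0 t1] rho0 rr'; rewrite /noise.
apply: weighted_increments => // i.
  by rewrite addr_ge0// mulr_ge0 ?subr_ge0 ?(ltW t1)// addr_ge0// mulr_ge0
    ?subr_ge0 ?(ltW rr').
rewrite ltrD2l ltr_pM2l ?subr_gt0// ltrD2l ltr_pM2l ?subr_gt0//.
by rewrite ltr_pM2r ?invr_gt0// ltr_nat.
Qed.

Let measurable_scaled_increment t x Y rho rho' : 0 <= t < 1 ->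
  brownian_bridge P W t x Y -> 0 <= rho < 1 -> 0 <= rho' < 1 ->
  measurable_fun setT (scaled_increment t rho rho' Y).
Proof.
move=> t01 bY r01 r'01; apply: measurable_funM => //.
by apply: measurable_funB; apply: measurable_funM => //;
  apply: (bridge_measurable bY); exact: rescale_itv.
Qed.

(** Both sides are limits of weighted sums of Brownian increments over the same
    subdivision of [rho, rho'], whose terms have the same laws. *)
Lemma scaled_increment_law t x Y t' x' Y' rho rho' : 0 <= t < 1 -> 0 <= t' < 1 ->
  brownian_bridge P W t x Y -> brownian_bridge P W t' x' Y' ->
  0 <= rho -> rho < rho' -> rho' < 1 ->
  forall A, <<s F (rescale t rho)>> A -> forall B, measurable B ->
  P (A `&` scaled_increment t rho rho' Y @^-1` B) =
  (P A * P (scaled_increment t' rho rho' Y' @^-1` B))%E.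
Proof.
move=> t01 t'01 bY bY' rho0 rr' r'1 A FA.
have rho01 : 0 <= rho < 1 by rewrite rho0 (lt_trans rr').
have rho'01 : 0 <= rho' < 1 by rewrite r'1 (le_trans rho0)// ltW.
have iN n := noise_indep n t01 rho0 rr'; have iN' n := noise_indep n t'01 rho0 rr'.
apply: (limit_law
  (f := fun n => partial_sum (noise t rho rho' n) n.+1)
  (g := fun n => partial_sum (noise t' rho rho' n) n.+1)).
- exact: filtration_measurable FA.
- by move=> n; exact: partial_sum_measurable (iN n).
- by move=> n; exact: partial_sum_measurable (iN' n).
- exact: measurable_scaled_increment bY _ _.
- exact: measurable_scaled_increment bY' _ _.
- exact: noise_cvg bY _ _ _.
- exact: noise_cvg bY' _ _ _.
- move=> n B mB; apply: (partial_sum_law (iN n) (iN' n)) => //; last first.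
    by rewrite /grid mul0r mulr0 addr0.
  move=> i ni C mC.
  have dr : 0 < rho' - rho by rewrite subr_gt0.
  have gi0 : 0 <= grid rho rho' n.+1 i by rewrite addr_ge0// mulr_ge0// ltW.
  have gii : grid rho rho' n.+1 i < grid rho rho' n.+1 i.+1.
    by rewrite ltrD2l ltr_pM2l// ltr_pM2r ?invr_gt0// ltr_nat.
  have gi1 : grid rho rho' n.+1 i.+1 < 1.
    rewrite (le_lt_trans _ r'1)// /grid -lerBrDl ler_piMr// ?(ltW dr)//.
    by rewrite ler_pdivrMr// mul1r ler_nat.
  by rewrite /noise !rescaled_noise_law.
Qed.

End bridge.

(** * The bridge on a mesh as a random walk *)

(** Completeness makes g measurable, so that g may be known only almost
    everywhere, as is the bridge stopped at an arbitrary time. *)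
Lemma complete_ae_eq_integral (R : realType) (d : measure_display)
    (T : measurableType d) (m : {measure set T -> \bar R}) (f g : T -> \bar R) :
  measure_is_complete m -> measurable_fun setT f ->
  (forall x, 0 <= f x)%E -> (forall x, 0 <= g x)%E ->
  {ae m, forall x, f x = g x} -> (\int[m]_x f x = \int[m]_x g x)%E.
Proof.
move=> cm mf f0 g0 fg.
have fg' : ae_eq m setT f g by apply: filterS fg => x + _.
have mg := ae_measurable_fun cm fg' mf.
exact: ge0_ae_eq_integral.
Qed.

Definition mesh (R : realType) (n k : nat) : R := k%:R / n.+1%:R.

Section mesh.
Context (R : realType) (n : nat).

Lemma mesh0 : mesh R n 0 = 0. Proof. by rewrite /mesh mul0r. Qed.

Lemma mesh_ge0 k : 0 <= mesh R n k. Proof. by rewrite divr_ge0. Qed.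

Lemma mesh_top : mesh R n n.+1 = 1. Proof. by rewrite /mesh divff. Qed.

Lemma ltr_mesh i j : (mesh R n i < mesh R n j) = (i < j)%N.
Proof. by rewrite ltr_pM2r ?invr_gt0// ltr_nat. Qed.

Lemma ler_mesh i j : (mesh R n i <= mesh R n j) = (i <= j)%N.
Proof. by rewrite ler_pM2r ?invr_gt0// ler_nat. Qed.

Lemma mesh_lt1 k : (mesh R n k < 1) = (k <= n)%N.
Proof. by rewrite -mesh_top ltr_mesh ltnS. Qed.

End mesh.

(** The walk driving the bridge along the mesh.  It is frozen from index n on:
    the index n.+1 is the time 1, where 1 - s vanishes and where the payoff does
    not depend on the state. *)
Definition bridge_walk (R : realType) (Omega : Type) (t x : R) (n : nat)
    (Y : R -> Omega -> R) (k : nat) (w : Omega) : R :=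
  let s := rescale t (mesh R n (minn k n)) in
  Num.sqrt (1 - t) * (Y s w / (1 - s) - x / (1 - t)).

Section bridge_walk.
Context (R : realType) (d : measure_display) (Omega : measurableType d).
Variables (P : probability Omega R) (W : R -> Omega -> R).
Hypothesis cP : measure_is_complete P.
Hypothesis bmW : standard_brownian_motion P W.

Local Notation F := (augmentation P W).

Lemma bridge_walk_adapted t x n Y k : 0 <= t < 1 -> brownian_bridge P W t x Y ->
  measurable_fun setT (bridge_walk t x n Y k
    : g_sigma_algebraType (F (rescale t (mesh R n k))) -> R).
Proof.
move=> t01 bY; have /andP[t0 t1] := t01.
apply: measurable_funM => //; apply: measurable_funB => //.
apply: measurable_funM => //.
move=> _ B mB; rewrite setTI.
apply: (filtration_nd (r := rescale t (mesh R n (minn k n)))).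
  by apply: rescale_nd => //; rewrite ler_mesh geq_minl.
rewrite -[X in _ X]setTI; apply: (bridge_adapted bY _ measurableT mB).
by apply: rescale_itv => //; rewrite mesh_ge0 mesh_lt1 geq_minr.
Qed.

Lemma bridge_walk_measurable t x n Y k : 0 <= t < 1 -> brownian_bridge P W t x Y ->
  measurable_fun setT (bridge_walk t x n Y k).
Proof.
move=> t01 bY _ B mB.
apply: (filtration_measurable cP bmW (s := rescale t (mesh R n k))).
have mS := @bridge_walk_adapted t x n Y k t01 bY.
exact: mS measurableT _ mB.
Qed.

Lemma bridge_walk_increment t x n (Y : R -> Omega -> R) k : (k < n)%N ->
  (fun w => bridge_walk t x n Y k.+1 w - bridge_walk t x n Y k w) =
  scaled_increment t (mesh R n k) (mesh R n k.+1) Y.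
Proof.
move=> kn; apply/funext => w; rewrite /bridge_walk /scaled_increment.
by rewrite (minn_idPl (ltnW kn)) (minn_idPl kn); ring.
Qed.

Lemma bridge_walk_frozen t x n (Y : R -> Omega -> R) k : (n <= k)%N ->
  (fun w => bridge_walk t x n Y k.+1 w - bridge_walk t x n Y k w) = cst 0.
Proof.
move=> nk; apply/funext => w; rewrite /bridge_walk.
by rewrite (minn_idPr nk) (minn_idPr (leqW nk)) subrr.
Qed.

Lemma bridge_walk_increment_law t x Y t' x' Y' n k : 0 <= t < 1 -> 0 <= t' < 1 ->
  brownian_bridge P W t x Y -> brownian_bridge P W t' x' Y' ->
  forall A, <<s F (rescale t (mesh R n k))>> A -> forall B, measurable B ->
  P (A `&` (fun w => bridge_walk t x n Y k.+1 w - bridge_walk t x n Y k w) @^-1` B) =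
  (P A * P ((fun w => bridge_walk t' x' n Y' k.+1 w - bridge_walk t' x' n Y' k w)%R
             @^-1` B))%E.
Proof.
move=> t01 t'01 bY bY' A FA B mB; have [kn|nk] := ltnP k n.
  rewrite !bridge_walk_increment//.
  apply: (scaled_increment_law cP bmW t01 t'01 bY bY') => //.
  - exact: mesh_ge0.
  - by rewrite ltr_mesh.
  - by rewrite mesh_lt1.
rewrite !bridge_walk_frozen// !preimage_cst; case: ifP => _.
  by rewrite setIT probability_setT mule1.
by rewrite setI0 measure0 mule0.
Qed.

Lemma bridge_start t x Y : 0 <= t < 1 -> brownian_bridge P W t x Y ->
  {ae P, forall w, Y t w = x}.
Proof.
move=> /andP[_ t1] [_ _ eY _]; apply: filterS eY => w /(_ t).
by rewrite lexx t1 set_itv1 Rintegral_set1 subr0 subrr addr0; apply.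
Qed.

Lemma bridge_walk_start t x n Y : 0 <= t < 1 -> brownian_bridge P W t x Y ->
  {ae P, forall w, bridge_walk t x n Y 0 w = 0}.
Proof.
move=> t01 bY; apply: filterS (bridge_start t01 bY) => w.
rewrite /bridge_walk min0n mesh0 /rescale mulr0 addr0 => ->.
by rewrite subrr mulr0.
Qed.

Lemma bridge_walk_payoff t x n Y : 0 <= t < 1 -> brownian_bridge P W t x Y ->
  {ae P, forall w k, (k <= n.+1)%N ->
    (expR (Y (rescale t (mesh R n k)) w))%:E =
    bridge_payoff (mesh R n) x (Num.sqrt (1 - t)) k (bridge_walk t x n Y k w)}.
Proof.
move=> /andP[t0 t1] [_ _ _ Y1]; apply: filterS Y1 => w Y1w k.
rewrite leq_eqVlt => /predU1P[->|]; rewrite /bridge_payoff.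
  by rewrite mesh_top /rescale mulr1 addrC subrK Y1w subrr mul0r.
rewrite ltnS => kn; congr (expR _)%:E.
rewrite /bridge_walk (minn_idPl kn) mulrA -expr2 sqr_sqrtr ?subr_ge0 ?(ltW t1)//.
have := kn; rewrite -(mesh_lt1 R); move: (mesh R n k) => rho rho1.
rewrite /rescale; field.
have -> : 1 - (t + (1 - t) * rho) = (1 - t) * (1 - rho) by ring.
by rewrite mulf_neq0 ?subr_eq0 ?gt_eqF.
Qed.

End bridge_walk.

(** * Reduction of the value function to meshes *)

Lemma limn_einf_le (R : realType) (u : (\bar R)^nat) (M : \bar R) :
  (forall n, u n <= M)%E -> (limn_einf u <= M)%E.
Proof.
move=> uM; rewrite limn_einf_lim; apply: lime_le.
  by apply: is_cvg_einfs.
apply: nearW => n; apply: le_trans (uM n).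
by apply: ereal_inf_lbound; exists n => /=.
Qed.

Lemma limn_einf_ge0 (R : realType) (u : (\bar R)^nat) :
  (forall n, 0 <= u n)%E -> (0 <= limn_einf u)%E.
Proof.
move=> u0; rewrite limn_einf_lim; apply: lime_ge; first exact: is_cvg_einfs.
by apply: nearW => n; apply: le_ereal_inf_tmp => _ [k _ <-].
Qed.

Section value.
Context (R : realType) (d : measure_display) (Omega : measurableType d).
Variables (P : probability Omega R) (W : R -> Omega -> R).
Variable X : R -> R -> R -> Omega -> R.
Hypothesis cP : measure_is_complete P.
Hypothesis bmW : standard_brownian_motion P W.
Hypothesis bX : forall t x : R, 0 <= t < 1 -> brownian_bridge P W t x (X t x).

Local Notation F := (augmentation P W).

Let zero01 : 0 <= (0 : R) < 1. Proof. by rewrite lexx ltr01. Qed.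

Let reference_increment n k (w : Omega) : R :=
  bridge_walk 0 0 n (X 0 0) k.+1 w - bridge_walk 0 0 n (X 0 0) k w.

Let reference_increment_measurable n k : measurable_fun setT (reference_increment n k).
Proof.
by apply: measurable_funB; apply: (bridge_walk_measurable cP bmW _ _ zero01 (bX 0 zero01)).
Qed.

Let reference_rv n k : {mfun Omega >-> R} :=
  HB.pack (reference_increment n k)
    (isMeasurableFun.Build _ _ _ _ _ (reference_increment_measurable n k)).

(** The common law of the k-th increments of all the walks, taken from the bridge
    started at 0 at time 0. *)
Definition step_law n k : probability R R := distribution P (reference_rv n k).

Definition mesh_value (t x : R) n : \bar R :=
  snell (step_law n) (bridge_payoff (mesh R n) x (Num.sqrt (1 - t))) n.+1 0 0.

Section fixed_start.
Variables (t x : R) (n : nat).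
Hypothesis t01 : 0 <= t < 1.

Let Y := X t x.
Let bY : brownian_bridge P W t x Y := bX x t01.
Let G k := F (rescale t (mesh R n k)).
Let S := bridge_walk t x n Y.
Let g := bridge_payoff (mesh R n) x (Num.sqrt (1 - t)).

Let sG k : <<s G k>> `<=` measurable.
Proof. exact: filtration_measurable. Qed.

Let ndG i j : (i <= j)%N -> <<s G i>> `<=` <<s G j>>.
Proof.
move=> ij; apply: filtration_nd; apply: rescale_nd; first by case/andP: t01.
by rewrite ler_mesh.
Qed.

Let mS k : measurable_fun setT (S k : g_sigma_algebraType (G k) -> R).
Proof. exact: bridge_walk_adapted. Qed.

Let incS k A : <<s G k>> A -> forall B, measurable B ->
  P (A `&` (fun w => S k.+1 w - S k w) @^-1` B) = (P A * step_law n k B)%E.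
Proof. exact: (bridge_walk_increment_law cP bmW t01 zero01 bY (bX 0 zero01)). Qed.

Let mg k : measurable_fun setT (g k).
Proof. exact: measurable_bridge_payoff. Qed.

Let g0 k s : (0 <= g k s)%E.
Proof. exact: bridge_payoff_ge0. Qed.

Let initial_value : (\int[P]_w snell (step_law n) g n.+1 0 (S 0%N w) = mesh_value t x n)%E.
Proof.
rewrite -(@complete_ae_eq_integral _ _ _ P (cst (mesh_value t x n))) //.
- exact: integral_probability_cst.
- by move=> w; apply: snell_ge0.
- by move=> w; apply: snell_ge0.
- by apply: filterS (bridge_walk_start n t01 bY) => w S0; rewrite /S S0.
Qed.

Let stopped_bridge_ae (kappa : Omega -> nat) : (forall w, (kappa w <= n.+1)%N) ->
  {ae P, forall w, g (kappa w) (S (kappa w) w) =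
                   (expR (Y (rescale t (mesh R n (kappa w))) w))%:E}.
Proof.
by move=> kn; apply: filterS (bridge_walk_payoff n t01 bY) => w H; exact/esym/H.
Qed.

Lemma stopped_bridge_measurable (kappa : Omega -> nat) :
  (forall i, <<s G i>> [set w | (kappa w <= i)%N]) ->
  (forall w, (kappa w <= n.+1)%N) ->
  measurable_fun setT (fun w => (expR (Y (rescale t (mesh R n (kappa w))) w))%:E).
Proof.
move=> sk kn.
have gY : ae_eq P setT (fun w => g (kappa w) (S (kappa w) w))
    (fun w => (expR (Y (rescale t (mesh R n (kappa w))) w))%:E).
  by apply: filterS (stopped_bridge_ae kn) => w + _.
exact: (ae_measurable_fun cP gY (measurable_stopped_payoff sG mS mg sk)).
Qed.

Let stopped_bridge (kappa : Omega -> nat) :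
  (forall i, <<s G i>> [set w | (kappa w <= i)%N]) ->
  (forall w, (kappa w <= n.+1)%N) ->
  (\int[P]_w g (kappa w) (S (kappa w) w) =
   \int[P]_w (expR (Y (rescale t (mesh R n (kappa w))) w))%:E)%E.
Proof.
move=> sk kn; apply: complete_ae_eq_integral => //.
- exact: (measurable_stopped_payoff sG mS mg sk).
- exact: stopped_bridge_ae.
Qed.

Lemma stopped_bridge_le (kappa : Omega -> nat) :
  (forall i, <<s G i>> [set w | (kappa w <= i)%N]) ->
  (forall w, (kappa w <= n.+1)%N) ->
  (\int[P]_w (expR (Y (rescale t (mesh R n (kappa w))) w))%:E <=
   mesh_value t x n)%E.
Proof.
move=> sk kn; rewrite -stopped_bridge// -initial_value.
apply: (stopped_payoff_le_snell sG ndG mS incS mg g0 sk).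
  exact: (@measurableT _ (g_sigma_algebraType (G 0%N))).
by move=> w _; rewrite add0n kn.
Qed.

Lemma mesh_value_attained : exists kappa : Omega -> nat,
  [/\ forall i, <<s G i>> [set w | (kappa w <= i)%N],
      forall w, (kappa w <= n.+1)%N
    & (\int[P]_w (expR (Y (rescale t (mesh R n (kappa w))) w))%:E =
       mesh_value t x n)%E].
Proof.
pose kappa := first_contact S (step_law n) g n.+1 0.
have sk i : <<s G i>> [set w | (kappa w <= i)%N].
  exact: (first_contact_stopping (step_law n) ndG mS mg g0).
have kn w : (kappa w <= n.+1)%N by exact: first_contact_le.
exists kappa; split => //.
rewrite -stopped_bridge// -initial_value.
apply/esym/(snell_attained sG ndG mS incS mg g0 n.+1).
exact: (@measurableT _ (g_sigma_algebraType (G 0%N))).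
Qed.

End fixed_start.

(** Rounding up to the mesh keeps stopping times: the rounded time is at most a
    point of the mesh when the original one is. *)
Definition mesh_index (q : R) (n : nat) : nat := `|Num.ceil (q * n.+1%:R)|%N.

Lemma mesh_index_le q n k : 0 <= q -> (mesh_index q n <= k)%N = (q <= mesh R n k).
Proof.
move=> q0; have y0 : 0 <= q * n.+1%:R by rewrite mulr_ge0.
rewrite /mesh_index -lez_nat gez0_abs; last first.
  by rewrite ceil_ge0 (lt_le_trans _ y0)// oppr_lt0.
by rewrite ceil_le_int /mesh ler_pdivlMr.
Qed.

Lemma mesh_index_lt q n : 0 <= q -> mesh R n (mesh_index q n) < q + n.+1%:R^-1.
Proof.
move=> q0; case E : (mesh_index q n) => [|k].
  by rewrite mesh0 ltr_wpDl// invr_gt0.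
have : mesh R n k < q by rewrite ltNge -mesh_index_le// E ltnn.
by rewrite /mesh -[k.+1%:R]natr1 mulrDl mul1r ltrD2r.
Qed.

(** The path need not be continuous at time 1: a time equal to 1 is itself a
    point of every mesh, and a time below 1 stays below 1 once rounded on a fine
    mesh. *)
Lemma rescaled_mesh_cvg (t tau : R) (y : R -> R) : 0 <= t < 1 -> 0 <= tau <= 1 - t ->
  {within `[t, 1[, continuous y} ->
  y (rescale t (mesh R n (mesh_index (tau / (1 - t)) n))) @[n --> \oo] --> y (t + tau).
Proof.
move=> /andP[t0 t1] /andP[tau0 tau1] cy.
have t10 : 0 < 1 - t by rewrite subr_gt0.
set q := tau / (1 - t).
have q0 : 0 <= q by rewrite divr_ge0// ltW.
have tauE : t + tau = rescale t q by rewrite /rescale /q mulrCA divff ?mulr1// gt_eqF.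
have [q1|q1] := ltP q 1; last first.
  have {}q1 : q = 1.
    by apply/eqP; rewrite eq_le q1 andbT /q ler_pdivrMr// mul1r.
  apply: cvg_near_cst; apply: nearW => n; rewrite tauE; congr (y (rescale t _)).
  apply/eqP; rewrite q1 eq_le; apply/andP; split.
    by rewrite -[leRHS](mesh_top R n) ler_mesh mesh_index_le// mesh_top.
  by rewrite -mesh_index_le.
rewrite tauE; apply/cvgrPdist_lt => e e0.
have qt1 : t <= rescale t q < 1 by rewrite rescale_itv ?t0 ?t1 ?q0 ?q1.
have /andP[tq qt] := qt1.
have /subspace_continuousP/(_ (rescale t q)) := cy.
rewrite /= in_itv/= tq qt => /(_ isT)/cvgrPdist_lt/(_ _ e0).
rewrite near_withinE => /nbhs_ballP[eta /= eta0 Heta].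
pose del := Num.min eta (1 - rescale t q).
have del0 : 0 < del by rewrite lt_min eta0 subr_gt0.
near=> n.
set r := mesh R n _.
have qr : q <= r by rewrite -mesh_index_le.
have rq : r - q < n.+1%:R^-1 by rewrite ltrBlDl; exact: mesh_index_lt.
have small : rescale t r - rescale t q < del.
  rewrite (_ : _ - _ = (1 - t) * (r - q)); last by rewrite /rescale; ring.
  apply: (@le_lt_trans _ _ (r - q)).
    by rewrite ler_piMl ?subr_ge0// lerBlDr lerDl.
  apply: (lt_trans rq); rewrite -[ltRHS]invrK ltf_pV2 ?posrE ?invr_gt0//.
  rewrite (@lt_trans _ _ n%:R) ?ltr_nat//.
  by near: n; exact: nbhs_infty_gtr.
have := small; rewrite lt_min => /andP[small1 small2].
have qr' : rescale t q <= rescale t r by exact: rescale_nd.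
apply: Heta; rewrite /ball/= ?in_itv/=.
  by rewrite distrC ger0_norm ?subr_ge0.
by rewrite (le_trans tq)//= -(ltrD2r (- rescale t q)).
Unshelve. all: by end_near. Qed.

(** A rule that is optimal on the mesh is an admissible time.  Conversely, if no
    mesh does better than exp x, then no rounded time does, and by Fatou's lemma
    neither does the time it approximates. *)
Lemma value_gtP (t x : R) : 0 <= t < 1 ->
  ((expR x)%:E < value P W X t x)%E <->
  exists n, ((expR x)%:E < mesh_value t x n)%E.
Proof.
move=> t01; have /andP[t0 t1] := t01; rewrite /value t1; split; last first.
  move=> [n]; have [kappa [sk kn <-]] := mesh_value_attained x n t01.
  move=> /lt_le_trans; apply; apply: ereal_sup_ubound => /=.
  exists (fun w => (1 - t) * mesh R n (kappa w)); last by rewrite unlock.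
  split.
    move=> w; rewrite mulr_ge0 ?mesh_ge0 ?subr_ge0 ?(ltW t1)//=.
    by rewrite ler_piMr ?subr_ge0 ?(ltW t1)// -(mesh_top R n) ler_mesh.
  move=> s ts.
  pose z := (s - t) / (1 - t) * n.+1%:R.
  have z0 : 0 <= z by rewrite mulr_ge0// divr_ge0 ?subr_ge0// ltW.
  (* index of the last mesh point that is not after s *)
  pose m := Num.truncn z.
  have le_mesh k : (t + (1 - t) * mesh R n k <= s) = (k <= m)%N.
    rewrite truncn_ge_nat// /z /mesh -ler_pdivrMr// ler_pdivlMr ?subr_gt0//.
    by rewrite lerBrDl mulrC.
  rewrite /augmented_filtration -/(augmentation P W s).
  apply: (filtration_nd (r := rescale t (mesh R n m))).
    by rewrite /rescale le_mesh.
  rewrite [X in _ X](_ : _ = [set w | (kappa w <= m)%N]); first exact: sk.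
  by apply/seteqP; split => w /=; rewrite le_mesh.
rewrite ltNge => /negP small; apply: contrapT => nV; apply: small.
apply: ge_ereal_sup => _ [tau [tau01 stau] <-]; rewrite unlock.
have Vle n : (mesh_value t x n <= (expR x)%:E)%E.
  by rewrite leNgt; apply/negP => ?; apply: nV; exists n.
pose kappa n w := mesh_index (tau w / (1 - t)) n.
have q0 w : 0 <= tau w / (1 - t).
  by have /andP[? _] := tau01 w; rewrite divr_ge0// subr_ge0 ltW.
have kn n w : (kappa n w <= n.+1)%N.
  have /andP[_ ?] := tau01 w.
  by rewrite mesh_index_le// mesh_top ler_pdivrMr ?subr_gt0// mul1r.
have sk n i : <<s F (rescale t (mesh R n i))>> [set w | (kappa n w <= i)%N].
  rewrite (_ : [set w | _] = [set w | t + tau w <= rescale t (mesh R n i)]).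
    by apply: stau; rewrite lerDl mulr_ge0 ?mesh_ge0// subr_ge0 ltW.
  apply/seteqP; split => w /=;
    by rewrite mesh_index_le// lerD2l ler_pdivrMr ?subr_gt0// mulrC.
pose f n w := (expR (X t x (rescale t (mesh R n (kappa n w))) w))%:E.
have mf n : measurable_fun setT (f n).
  exact: (stopped_bridge_measurable x t01 (sk n) (kn n)).
have f0 n w : (0 <= f n w)%E by rewrite lee_fin expR_ge0.
rewrite -(@complete_ae_eq_integral _ _ _ P (fun w => limn_einf (f ^~ w))) //; last 3 first.
- apply: (emeasurable_fun_cvg (fun n w => einfs (f ^~ w) n)).
    exact: measurable_fun_einfs.
  by move=> w _; rewrite limn_einf_lim; exact: is_cvg_einfs.
- by move=> w; apply: limn_einf_ge0.
- have [_ cY _ _] := bX x t01.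
  apply: filterS cY => w cYw.
  suff /cvg_limn_einf_sup[-> _] : f ^~ w @ \oo --> (expR (X t x (t + tau w) w))%:E by [].
  apply: cvg_EFin; first exact: nearW.
  apply: continuous_cvg; first exact: continuous_expR.
  exact: (rescaled_mesh_cvg t01 (tau01 w) cYw).
apply: (le_trans (fatou _ measurableT mf (fun n w _ => f0 n w))).
apply: limn_einf_le => n; apply: le_trans (Vle n).
exact: (stopped_bridge_le x t01 (sk n) (kn n)).
Qed.

End value.

(** * Monotonicity of the boundary *)

Section boundary.
Context (R : realType) (d : measure_display) (Omega : measurableType d).
Variables (P : probability Omega R) (W : R -> Omega -> R).
Variable X : R -> R -> R -> Omega -> R.
Hypothesis cP : measure_is_complete P.
Hypothesis bmW : standard_brownian_motion P W.
Hypothesis bX : forall t x : R, 0 <= t < 1 -> brownian_bridge P W t x (X t x).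

(** An earlier start has a larger volatility sqrt (1 - t). *)
Lemma value_gt_nonincreasing (s t x : R) : 0 <= s -> s <= t -> t < 1 -> 0 <= x ->
  ((expR x)%:E < value P W X t x)%E -> ((expR x)%:E < value P W X s x)%E.
Proof.
move=> s0 st t1 x0.
have t01 : 0 <= t < 1 by rewrite (le_trans s0).
have s01 : 0 <= s < 1 by rewrite s0 (le_lt_trans st).
move=> /(value_gtP cP bmW bX x t01)[n Vn].
apply/(value_gtP cP bmW bX x s01); exists n.
apply: snell_volatility_gt Vn => //.
- by move=> k; rewrite ler_mesh.
- by rewrite sqrtr_ge0/= ler_wsqrtr// lerD2l lerN2.
- by rewrite sqrtr_gt0 subr_gt0 (le_lt_trans st).
- exact: mesh0.
Qed.

(** Running the bridge until time 1 pays exp 0. *)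
Lemma value_gt_neg (t x : R) : 0 <= t < 1 -> x < 0 ->
  ((expR x)%:E < value P W X t x)%E.
Proof.
move=> t01 x0; have /andP[t0 t1] := t01; have [_ _ _ X1] := bX x t01.
rewrite /value t1.
apply: (@lt_le_trans _ _ 1%E); first by rewrite lte_fin expR_lt1.
apply: ereal_sup_ubound; exists (cst (1 - t)).
  split=> [w|s ts]; first by rewrite /= subr_ge0 (ltW t1) lexx.
  rewrite /augmented_filtration.
  have [h|h] := boolP (t + (1 - t) <= s).
    rewrite [X in _ X](_ : _ = setT); last by apply/seteqP; split.
    exact: (@measurableT _ (g_sigma_algebraType (augmentation P W s))).
  rewrite [X in _ X](_ : _ = set0); first exact: sigma_algebra0.
  by apply/seteqP; split => w //=; apply/negP.
rewrite unlock -(@complete_ae_eq_integral _ _ _ P (cst 1%E))//.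
  exact: integral_probability_cst.
apply: filterS X1 => w X1w; rewrite /=.
by rewrite [t + _]addrC subrK X1w expR0.
Qed.

Lemma optimal_boundary_ge0 (t : R) : 0 <= t -> (0 <= optimal_boundary P W X t)%E.
Proof.
move=> t0; rewrite /optimal_boundary; case: ifPn => // t1.
apply/lee_addgt0Pr => e e0.
rewrite -leeBlDr// sub0e.
by apply: ereal_sup_ubound; exists (- e) => //=; apply: value_gt_neg; rewrite ?t0// oppr_lt0.
Qed.

End boundary.

Theorem theorem4p1 (R : realType) (d : measure_display)
    (Omega : measurableType d) (P : probability Omega R)
    (W : R -> Omega -> R) (X : R -> R -> R -> Omega -> R) :
  measure_is_complete P ->
  standard_brownian_motion P W ->
  (forall t x : R, 0 <= t < 1 -> brownian_bridge P W t x (X t x)) ->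
  {in `[0, 1] &, nonincreasing_fun (optimal_boundary P W X)}.
Proof.
move=> cP bmW bX s t; rewrite !in_itv/= => /andP[s0 _] /andP[t0 _] st.
have b_ge0 := optimal_boundary_ge0 cP bX s0.
rewrite [leLHS]/optimal_boundary; case: ifPn => // t1.
apply: ge_ereal_sup => _ [x /= Vx <-].
have [x0|x0] := leP 0 x; last by rewrite (le_trans _ b_ge0)// lee_fin ltW.
rewrite /optimal_boundary (le_lt_trans st t1).
apply: ereal_sup_ubound; exists x => //=.
exact: value_gt_nonincreasing Vx.
Qed.
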